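(* Let $X$ be a compact 4-manifold and $E\to X$ an $\mathrm{SO}(3)$-bundle. For every definite connection $A$ in $E$ the energy $\mathcal E(A)=\int_X |Q(A)|^2\,\mu(A)$ satisfies the topological lower bound $$\mathcal E(A)\ \geq\ 8\pi^2\, p_1(E).$$ Equality holds if and only if $A$ is perfect.
   Context: $E\to X$ is an $\mathrm{SO}(3)$-bundle (an oriented rank-3 real vector bundle with fibrewise inner product) over a 4-manifold. $\mathfrak{so}(E)$, the bundle of Lie algebras of skew endomorphisms of $E$, carries the inner product given by (minus) the Killing form. The fibrewise orientation gives (via a suitably rescaled cross product) an isometry $E\cong\mathfrak{so}(E)$, and one freely identifies $E\cong\mathfrak{so}(E)\cong\mathfrak{so}(E)^*\cong E^*$. A metric connection $A$ in $E$ is definite if its curvature $F_A$ satisfies $F_A(u,v)\neq 0$ for all linearly independent tangent vectors $u,v$. Write locally $F_A=\sum_i F_i\otimes e_i$ with $e_1,e_2,e_3$ an orthonormal frame of $\mathfrak{so}(E)\cong E$. Then $A$ is definite if and only if the 2-forms $F_i$ span at each point a 3-dimensional subspace of $\Lambda^2$ on which the wedge product is a definite form. $X$ is oriented so that this form is positive. Set $\mu(A)=\frac13\sum_i F_i\wedge F_i=\frac{8\pi^2}{3}p_1(A)$, a volume form, where $p_1(A)$ is the first Pontrjagin form of $A$. Here $p_1(E)$ also denotes the number $\int_X p_1(A)$. $Q(A)$ is the symmetric bilinear form on $E$ given by $Q(A)(u,v)=F_A(u)\wedge F_A(v)/\mu(A)$, i.e. by the matrix $Q(A)_{ij}=F_i\wedge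 F_j/\mu(A)$, and $|Q(A)|^2=\sum_{i,j}Q(A)_{ij}Q(A)_{ji}$. $A$ is perfect if $F_i\wedge F_j=\delta_{ij}\mu(A)$, i.e. $Q(A)_{ij}=\delta_{ij}$. *)

(* Defs.v *)
From HB Require Import structures.
From mathcomp Require Import all_boot all_order all_algebra.
From mathcomp Require Import all_classical all_reals all_analysis.

Set Implicit Arguments.
Unset Strict Implicit.
Unset Printing Implicit Defensive.

Import Order.TTheory GRing.Theory Num.Theory.
Import numFieldNormedType.Exports.

Local Open Scope classical_set_scope.
Local Open Scope ring_scope.

Section Smooth.
Context {R : realType}.
Implicit Types (f : 'rV[R]_4 -> R) (U : set 'rV[R]_4).

Definition partial (k : 'I_4) f : 'rV[R]_4 -> R :=
  fun y => 'D_(delta_mx 0 k) f y.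

(* f is infinitely differentiable on the open set U. *)
Definition smooth_on U f :=
  forall (s : seq 'I_4) (y : 'rV[R]_4), U y -> differentiable (foldr partial f s) y.

(* Lebesgue measure on R^4, carried by R * R * R * R; of_coords identifies
   this product with 'rV[R]_4. *)
Definition leb4 :=
  (@lebesgue_measure R \x @lebesgue_measure R
     \x @lebesgue_measure R \x @lebesgue_measure R)%E.

Definition of_coords (p : R * R * R * R) : 'rV[R]_4 :=
  let: (x0, x1, x2, x3) := p in \row_k [:: x0; x1; x2; x3]`_k.

End Smooth.

(* A compact smooth 4-manifold (without boundary).  Second countability
   follows from compactness.  chart i and ichart i are only meaningful on
   chart_dom i and its image. *)
Record compact_manifold4 (R : realType) := CompactManifold4 {
  points :> topologicalType;
  points_hausdorff : hausdorff_space points;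
  points_compact : compact [set: points];
  chart_idx : Type;
  chart_dom : chart_idx -> set points;
  chart : chart_idx -> points -> 'rV[R]_4;
  ichart : chart_idx -> 'rV[R]_4 -> points;
  chart_dom_open : forall i, open (chart_dom i);
  chart_cover : forall x, exists i, chart_dom i x;
  chart_im_open : forall i, open (chart i @` chart_dom i);
  chartK : forall i x, chart_dom i x -> ichart i (chart i x) = x;
  chart_continuous : forall i x, chart_dom i x -> {for x, continuous (chart i)};
  ichart_continuous : forall i y, (chart i @` chart_dom i) y ->
    {for y, continuous (ichart i)};
  chart_smooth : forall i j k,
    smooth_on (chart j @` (chart_dom i `&` chart_dom j))
      (fun y => chart i (ichart j y) 0 k)
}.

(* An oriented rank 3 real vector bundle with fibrewise inner product, given by
   its fibres and by oriented orthonormal frames over open sets triv_dom a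
   covering X.  Each triv_dom a lies in the domain of a chart of X, whose
   coordinates are used over triv_dom a. *)
Record so3_bundle (R : realType) (X : compact_manifold4 R) := So3Bundle {
  fibre : X -> lmodType R;
  inner : forall x, fibre x -> fibre x -> R;
  innerC : forall x (u v : fibre x), inner u v = inner v u;
  innerDl : forall x (c : R) (u v w : fibre x),
    inner (c *: u + v) w = c * inner u w + inner v w;
  triv_idx : Type;
  triv_dom : triv_idx -> set X;
  triv_chart : triv_idx -> chart_idx X;
  frame : triv_idx -> forall x, 'I_3 -> fibre x;
  triv_dom_open : forall a, open (triv_dom a);
  triv_cover : forall x, exists a, triv_dom a x;
  triv_dom_chart : forall a, triv_dom a `<=` chart_dom (triv_chart a);
  frame_orthonormal : forall a x, triv_dom a x ->
    forall i j, inner (frame a x i) (frame a x j) = (i == j)%:R;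
  frame_basis : forall a x, triv_dom a x ->
    forall v, v = \sum_i inner (frame a x i) v *: frame a x i;
  frame_oriented : forall a b x, triv_dom a x -> triv_dom b x ->
    \det (\matrix_(i, j) inner (frame a x i) (frame b x j)) = 1;
  frame_smooth : forall a b i j,
    smooth_on (chart (triv_chart b) @` (triv_dom a `&` triv_dom b))
      (fun y => let x := ichart (triv_chart b) y in
                inner (frame a x i) (frame b x j))
}.

Section Bundle.
Context {R : realType} {X : compact_manifold4 R} (E : so3_bundle X).
Implicit Types (a b : triv_idx E) (y : 'rV[R]_4).

Definition coord a : X -> 'rV[R]_4 := chart (triv_chart a).
Definition icoord a : 'rV[R]_4 -> X := ichart (triv_chart a).
Definition coord_dom a : set 'rV[R]_4 := coord a @` triv_dom a.
Definition coord_change a b (y : 'rV[R]_4) : 'rV[R]_4 := coord a (icoord b y).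

(* The change of frame e^b_j = \sum_i g_ij e^a_i, in the coordinates of b. *)
Definition transition a b y : 'M[R]_3 :=
  \matrix_(i, j) inner (frame a (icoord b y) i) (frame b (icoord b y) j).

(* A metric connection, through its connection matrices: in the frame a,
   nabla_(d/dy_k) e_j = \sum_i (conn a y k) i j *: e_i. *)
Record metric_connection := MetricConnection {
  conn : triv_idx E -> 'rV[R]_4 -> 'I_4 -> 'M[R]_3;
  conn_skew : forall a y k, coord_dom a y -> (conn a y k)^T = - conn a y k;
  conn_smooth : forall a k i j, smooth_on (coord_dom a) (fun y => conn a y k i j);
  conn_transition : forall a b y k,
    (coord b @` (triv_dom a `&` triv_dom b)) y ->
    let g := transition a b in
    conn b y k =
      (g y)^T *m (\sum_l partial k (fun z => coord_change a b z 0 l) y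
                    *: conn a (coord_change a b y) l) *m g y
      + (g y)^T *m \matrix_(i, j) partial k (fun z => g z i j) y
}.

End Bundle.

Section So3.
Context {R : realType}.

(* hat c is the matrix of the cross product w |-> c x w; vee is its inverse on
   skew matrices.  Indices are added modulo 3. *)
Definition hat (c : 'rV[R]_3) : 'M[R]_3 :=
  \matrix_(i, j) if j == i + 1 then - c 0 (i + 2)
                 else if j == i + 2 then c 0 (i + 1) else 0.

Definition vee (m : 'M[R]_3) : 'rV[R]_3 := \row_k m (k + 2) (k + 1).

Definition lie_bracket (a b : 'M[R]_3) : 'M[R]_3 := a *m b - b *m a.

(* The trace of ad a \o ad b on so(3), in the basis hat (delta_mx 0 j). *)
Definition killing (a b : 'M[R]_3) : R :=
  \sum_j vee (lie_bracket a (lie_bracket b (hat (delta_mx 0 j)))) 0 j.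

Definition so_inner (a b : 'M[R]_3) : R := - killing a b.

(* The frame of so(E) corresponding to an oriented orthonormal frame of E; as
   so_inner (hat c) (hat c) is twice the squared norm of c, the rescaling
   factor of the cross product is 1 / sqrt 2. *)
Definition so_frame (i : 'I_3) : 'M[R]_3 :=
  (Num.sqrt 2)^-1 *: hat (delta_mx 0 i).

(* The coefficient of alpha /\ beta on dy_0 dy_1 dy_2 dy_3, a 2-form alpha
   being given by its values alpha k l on the coordinate vectors k and l. *)
Definition wedge (alpha beta : 'I_4 -> 'I_4 -> R) : R :=
  alpha 0 1 * beta 2 3 - alpha 0 2 * beta 1 3 + alpha 0 3 * beta 1 2
  + alpha 1 2 * beta 0 3 - alpha 1 3 * beta 0 2 + alpha 2 3 * beta 0 1.

End So3.

Section Connection.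
Context {R : realType} {X : compact_manifold4 R} {E : so3_bundle X}.
Variable A : metric_connection E.
Implicit Types (a : triv_idx E) (y : 'rV[R]_4).

(* The component F(d/dy_k, d/dy_l) of F = dA + A /\ A, in the frame a. *)
Definition curvature a y (k l : 'I_4) : 'M[R]_3 :=
  \matrix_(i, j) partial k (fun z => conn A a z l i j) y
  - \matrix_(i, j) partial l (fun z => conn A a z k i j) y
  + lie_bracket (conn A a y k) (conn A a y l).

Definition curvature_at a y (u v : 'rV[R]_4) : 'M[R]_3 :=
  \sum_k \sum_l (u 0 k * v 0 l) *: curvature a y k l.

Definition definite : Prop :=
  forall a y, coord_dom a y -> forall u v : 'rV[R]_4,
    free [:: u; v] -> curvature_at a y u v != 0.

(* The 2-forms F_i in F = \sum_i F_i (x) so_frame i. *)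
Definition F_ a y (i : 'I_3) : 'I_4 -> 'I_4 -> R :=
  fun k l => so_inner (curvature a y k l) (so_frame i).

Definition mu a y : R := 3^-1 * \sum_i wedge (F_ a y i) (F_ a y i).

Definition Q a y : 'M[R]_3 :=
  \matrix_(i, j) (wedge (F_ a y i) (F_ a y j) / mu a y).

Definition normQ2 a y : R := \sum_i \sum_j Q a y i j * Q a y j i.

Definition perfect : Prop :=
  forall a y, coord_dom a y -> forall i j,
    wedge (F_ a y i) (F_ a y j) = (i == j)%:R * mu a y.

(* Chern-Weil: p_1(A) = - tr (F /\ F) / (8 pi^2). *)
Definition p1_form a y : R :=
  - (8 * pi ^+ 2)^-1 *
    \sum_i \sum_j wedge (fun k l => curvature a y k l i j)
                        (fun k l => curvature a y k l j i).

(* The orientation of X for which the wedge product is positive on the span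
   of the F_i: the sign at y of the coordinates a, that is the sign of the
   values of F_i /\ F_i on d/dy_0, ..., d/dy_3. *)
Definition orientation a y : R := Num.sg (mu a y).

End Connection.

Section Integral.
Context {R : realType} {X : compact_manifold4 R} (E : so3_bundle X).

(* A finite continuous partition of unity subordinate to the cover triv_dom. *)
Record partition_of_unity := PartitionOfUnity {
  pou_size : nat;
  pou_idx : 'I_pou_size -> triv_idx E;
  pou_fun : 'I_pou_size -> X -> R;
  pou_continuous : forall k, continuous (pou_fun k);
  pou_ge0 : forall k x, 0 <= pou_fun k x;
  pou_supp : forall k,
    closure [set x | pou_fun k x != 0] `<=` triv_dom (pou_idx k);
  pou_sum1 : forall x, \sum_k pou_fun k x = 1
}.

Lemma bump_exists (x : X) : exists (a : triv_idx E) (f : X -> R),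
  [/\ continuous f, forall z, 0 <= f z, f x = 1 &
      closure [set z | f z != 0] `<=` triv_dom a].
Proof.
have [a ax] := triv_cover E x; exists a.
have hX := points_hausdorff (c := X); have cX := points_compact (c := X).
have Wx : nbhs x (triv_dom a) by apply: open_nbhs_nbhs; split=> //; exact: triv_dom_open.
have [U Ux UW] := compact_regular hX cX filterT Wx.
have c1 : closed [set x] by exact/accessible_closed_set1/hausdorff_accessible.
have cU : closed (~` U°) by exact/open_closedC/open_interior.
have dU : ~` U° `&` [set x] = set0.
  by apply/seteqP; split=> // z [/= nU zx]; apply: nU; rewrite zx.
have /(_ (compact_normal hX cX)) := (normal_separatorP (R := R) (T := X)).1.
move=> /(_ _ _ cU c1 dU)/(uniform_separatorP (R := R))[f [cf f01 f0 f1]].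
exists f; split=> //.
- move=> z; have : range f (f z) by exists z.
  by move/f01; rewrite /= in_itv /= => /andP[].
- by apply: f1; exists x.
- apply: subset_trans UW; apply: closureS => z /= fz.
  apply: contrapT => nUz; move/eqP: fz; apply; apply: f0; exists z => //.
  by move=> /interior_subset.
Qed.

Lemma partition_of_unity_exists : inhabited partition_of_unity.
Proof.
have /choice[a /choice[f fP]] := bump_exists.
have [[x0]|X0] := pselect (inhabited X); last first.
  have noX (x : X) : False by apply: X0.
  apply: inhabits; apply: (@PartitionOfUnity 0 (fun k => ltac:(by case: k))
    (fun k => ltac:(by case: k))) => [[]//|[]//|[]//|x]; by case: (noX x).
pose T : ptopologicalType := HB.pack (Topological.sort X) (Topological.class X)
  (isPointed.Build (Topological.sort X) x0).
have : @compact T setT := points_compact (c := X); rewrite compact_cover.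
move=> /(_ X setT (fun x => [set z | 0 < f x z])) [].
- move=> x _; have [cf _ _ _] := fP x.
  suff : open (f x @^-1` [set r | 0 < r]) by [].
  by apply: open_comp => [z _|]; [exact: cf|exact: open_gt].
- by move=> x _; exists x => //=; have [_ _ -> _] := fP x.
move=> D _ covD; pose s : seq X := finmap.enum_fset D.
pose g (k : 'I_(size s)) : X -> R := f (tnth (in_tuple s) k).
pose G x : R := \sum_k g k x.
have g0 k z : 0 <= g k z by rewrite /g; have [] := fP (tnth (in_tuple s) k).
have cg k : continuous (g k) by rewrite /g; have [] := fP (tnth (in_tuple s) k).
have Gp z : 0 < G z.
  have [x /= xD fxz] := covD z I.
  have /tnthP[k xk] : x \in in_tuple s by [].
  rewrite /G (bigD1 k)//= ltr_pwDl ?sumr_ge0//.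
  by rewrite /g -xk.
have cG : continuous G.
  by apply: (@continuous_big _ _ _ _ xpredT) => // -[u v]; exact: add_continuous.
have gG k z : (g k z / G z != 0) = (g k z != 0).
  by rewrite mulf_eq0 invr_eq0 (gt_eqF (Gp z)) orbF.
apply: inhabits.
apply: (@PartitionOfUnity (size s) (fun k => a (tnth (in_tuple s) k))
  (fun k z => g k z / G z)).
- move=> k z; apply: cvgM; first exact: cg.
  by apply: cvgV; [exact/lt0r_neq0/Gp|exact: cG].
- by move=> k z; rewrite divr_ge0// ltW.
- move=> k; under eq_set do rewrite gG.
  by rewrite /g; have [] := fP (tnth (in_tuple s) k).
- by move=> z; rewrite -mulr_suml -/(G z) divff ?gt_eqF ?Gp.
Qed.

(* The integral over X of the 4-form with coefficient omega a in the coordinates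
   a; o a y is the sign at y of the coordinates a for the orientation of X.
   By the change of variables formula it does not depend on the partition of
   unity, for which continuity is enough. *)
Definition form_integral (o omega : triv_idx E -> 'rV[R]_4 -> R) : R :=
  let P := inhabited_witness partition_of_unity_exists in
  \sum_(k < pou_size P) let a := pou_idx k in
    \int[leb4]_(p in of_coords @^-1` coord_dom a)
      (pou_fun k (icoord a (of_coords p)) * o a (of_coords p)
         * omega a (of_coords p)).

End Integral.

Section Energy.
Context {R : realType} {X : compact_manifold4 R} {E : so3_bundle X}.
Variable A : metric_connection E.

Definition energy : R :=
  form_integral (orientation A) (fun a y => normQ2 A a y * mu A a y).

Definition p1_number : R := form_integral (orientation A) (p1_form A).

End Energy.

(* Main.v *)
Require Import Defs.
From mathcomp Require Import all_boot all_order all_algebra.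
From mathcomp Require Import all_classical all_reals all_analysis.
From mathcomp Require Import measurable_realfun.
From mathcomp Require Import ring lra zify.
(* vector.v also exports a coord. *)
Import Defs.

(**
In an orthonormal frame 8 pi^2 p_1(A) = 3 mu(A), and definiteness makes mu(A)
nowhere zero: a degenerate form G in the span of the F_i has some u <> 0 in its
kernel, and the two remaining equations F_i(v, u) = 0 then have a solution v
independent of u.  Hence tr Q = 3, so that |Q|^2 - 3 = |Q - 1|^2 >= 0, and
  E(A) - 8 pi^2 p_1(E) = \int_X (|Q|^2 - 3) |mu(A)|
is nonnegative; it vanishes only if the continuous integrand does.

The integral is a sum over the charts of one partition of unity.  Its vanishing
gives perfection, at each point, in some frame of that partition, whereas
perfection is asked in all frames.  One passes from one to the other by the
transformation law of the curvature, which rests on the symmetry of second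
derivatives: F^b = g^T (phi^* F^a) g, so the Gram matrices of the F_i for
the wedge product satisfy W^b = d P^T W^a P with P orthogonal.
*)

Set Implicit Arguments.
Unset Strict Implicit.
Unset Printing Implicit Defensive.

Import Order.TTheory GRing.Theory Num.Theory.
Import numFieldNormedType.Exports.

Local Open Scope classical_set_scope.
Local Open Scope ring_scope.

(** * Sums and case analysis over three and four indices *)

Lemma sum3 (V : nmodType) (F : 'I_3 -> V) : \sum_i F i = F 0 + F 1 + F 2.
Proof.
rewrite !big_ord_recl big_ord0 addr0 addrA; congr (F _ + F _ + F _); exact/val_inj.
Qed.

Lemma sum4 (V : nmodType) (F : 'I_4 -> V) : \sum_i F i = F 0 + F 1 + F 2 + F 3.
Proof.
rewrite !big_ord_recl big_ord0 addr0 !addrA.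
congr (F _ + F _ + F _ + F _); exact/val_inj.
Qed.

Lemma ord3P (P : 'I_3 -> Prop) : P 0 -> P 1 -> P 2 -> forall i, P i.
Proof.
move=> P0 P1 P2 [[|[|[|//]]] h].
- by rewrite (_ : Ordinal h = 0) //; apply: val_inj.
- by rewrite (_ : Ordinal h = 1) //; apply: val_inj.
- by rewrite (_ : Ordinal h = 2) //; apply: val_inj.
Qed.

Lemma ord4P (P : 'I_4 -> Prop) : P 0 -> P 1 -> P 2 -> P 3 -> forall i, P i.
Proof.
move=> P0 P1 P2 P3 [[|[|[|[|//]]]] h].
- by rewrite (_ : Ordinal h = 0) //; apply: val_inj.
- by rewrite (_ : Ordinal h = 1) //; apply: val_inj.
- by rewrite (_ : Ordinal h = 2) //; apply: val_inj.
- by rewrite (_ : Ordinal h = 3) //; apply: val_inj.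
Qed.

(** * Linear algebra of so(3)-valued 2-forms *)

Section Algebra.
Context {R : realType}.
Implicit Types (al be : 'I_4 -> 'I_4 -> R) (M g : 'M[R]_3).

(** Column [k] of [J] holds the components of the image of the coordinate vector [k], so that [J] is
    the Jacobian matrix of a change of coordinates. *)
Definition pullback (J : 'M[R]_4) al : 'I_4 -> 'I_4 -> R :=
  fun k l => \sum_p \sum_q J p k * J q l * al p q.

Lemma wedge_pullback (J : 'M[R]_4) : exists d, forall al be,
  (forall k l, al k l = - al l k) -> (forall k l, be k l = - be l k) ->
  wedge (pullback J al) (pullback J be) = d * wedge al be.
Proof.
(* The witness is det J, in its Laplace expansion along the first two rows: 2 x 2 minors of rows 0,
   1 are paired with the complementary minors of rows 2, 3. *)
exists (wedge (fun k l => J 0 k * J 1 l - J 1 k * J 0 l)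
              (fun k l => J 2 k * J 3 l - J 3 k * J 2 l)) => al be sal sbe.
have diag a : (forall k l : 'I_4, a k l = - a l k) -> forall k, a k k = 0 :> R.
  by move=> sa k; have := sa k k; lra.
have da := diag _ sal; have db := diag _ sbe.
rewrite /wedge /pullback !sum4 !da !db.
rewrite (sal 1 0) (sal 2 0) (sal 3 0) (sal 2 1) (sal 3 1) (sal 3 2).
rewrite (sbe 1 0) (sbe 2 0) (sbe 3 0) (sbe 2 1) (sbe 3 1) (sbe 3 2).
ring.
Qed.

Lemma hatE (c : 'rV[R]_3) :
  ((hat c 0 0 = 0) * (hat c 0 1 = - c 0 2) * (hat c 0 2 = c 0 1) *
  (hat c 1 0 = c 0 2) * (hat c 1 1 = 0) * (hat c 1 2 = - c 0 0) *
  (hat c 2 0 = - c 0 1) * (hat c 2 1 = c 0 0) * (hat c 2 2 = 0))%type.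
Proof.
refine (_, _, _, _, _, _, _, _, _); rewrite /hat mxE /=;
  try congr (- _); try congr (c _ _); (by [] || exact: val_inj).
Qed.

Lemma veeE M :
  ((vee M 0 0 = M 2 1) * (vee M 0 1 = M 0 2) * (vee M 0 2 = M 1 0))%type.
Proof. by refine (_, _, _); rewrite mxE; congr (M _ _); apply: val_inj. Qed.

Lemma skewE M : M^T = - M -> forall i j, M i j = - M j i.
Proof. by move=> /matrixP h i j; have := h i j; rewrite !mxE => ->; rewrite opprK. Qed.

Lemma skew_diag M : M^T = - M -> forall i, M i i = 0.
Proof. by move=> /skewE h i; have := h i i; lra. Qed.

Lemma hat_vee M : M^T = - M -> hat (vee M) = M.
Proof.
move=> sM; apply/matrixP; apply: ord3P; apply: ord3P; rewrite hatE ?veeE ?(skew_diag sM)//;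
  by rewrite [RHS](skewE sM).
Qed.

Lemma lie_bracketE (a b : 'M[R]_3) i j : lie_bracket a b i j =
  a i 0 * b 0 j + a i 1 * b 1 j + a i 2 * b 2 j
  - (b i 0 * a 0 j + b i 1 * a 1 j + b i 2 * a 2 j).
Proof. by rewrite !mxE !sum3. Qed.

Lemma hatK (c : 'rV[R]_3) : vee (hat c) = c.
Proof. by apply/rowP; apply: ord3P; rewrite veeE hatE. Qed.

Definition cross (a b : 'rV[R]_3) : 'rV[R]_3 :=
  \row_i (a 0 (i + 1) * b 0 (i + 2) - a 0 (i + 2) * b 0 (i + 1)).

Lemma crossE (a b : 'rV[R]_3) :
  ((cross a b 0 0 = a 0 1 * b 0 2 - a 0 2 * b 0 1) *
  (cross a b 0 1 = a 0 2 * b 0 0 - a 0 0 * b 0 2) *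
  (cross a b 0 2 = a 0 0 * b 0 1 - a 0 1 * b 0 0))%type.
Proof.
refine (_, _, _); rewrite mxE; congr (a _ _ * b _ _ - a _ _ * b _ _); exact: val_inj.
Qed.

Lemma lie_bracket_hat (a b : 'rV[R]_3) :
  lie_bracket (hat a) (hat b) = hat (cross a b).
Proof.
apply/matrixP; apply: ord3P; apply: ord3P;
  by rewrite lie_bracketE !hatE ?crossE; ring.
Qed.

(** Under [hat] the bracket is the cross product, and the map v |-> c x (d x v) = (c . v) d - (c .
    d) v has trace -2 c . d. *)
Lemma so_inner_hat (c d : 'rV[R]_3) : so_inner (hat c) (hat d) = 2 * \sum_i c 0 i * d 0 i.
Proof.
rewrite /so_inner /killing !sum3 !lie_bracket_hat !hatK !crossE !mxE /=.
ring.
Qed.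

(** The factor is 2 / sqrt 2: the inner product doubles the dot product, and [so_frame] divides by
    sqrt 2. Thus each F_i is sqrt 2 times a coordinate of the curvature under [vee]. *)
Lemma so_inner_frame M i : M^T = - M ->
  so_inner M (so_frame i) = Num.sqrt 2 * vee M 0 i.
Proof.
move=> /hat_vee {1}<-.
have -> : so_frame i = hat ((Num.sqrt (2 : R))^-1 *: delta_mx 0 i).
  by apply/matrixP => p q; rewrite /so_frame /hat !mxE; case: ifP => _; [|case: ifP => _];
    rewrite ?mulr0// mulrN.
rewrite so_inner_hat (bigD1 i) //= big1 ?addr0 => [|j ji].
  have s0 : Num.sqrt 2 != 0 :> R by rewrite gt_eqF// sqrtr_gt0.
  by rewrite !mxE !eqxx mulr1 -{1}(@sqr_sqrtr _ (2 : R))//; field.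
by rewrite !mxE eqxx (negPf ji) !mulr0.
Qed.

Lemma wedge_sum n (c d : 'I_n -> R) (al be : 'I_n -> 'I_4 -> 'I_4 -> R) :
  wedge (fun k l => \sum_i c i * al i k l) (fun k l => \sum_j d j * be j k l)
  = \sum_i \sum_j c i * d j * wedge (al i) (be j).
Proof.
have term p q r s : (\sum_i c i * al i p q) * (\sum_j d j * be j r s) =
    \sum_i \sum_j c i * d j * (al i p q * be j r s).
  by rewrite big_distrlr; do 2 (apply: eq_bigr => ? _); rewrite mulrACA.
rewrite /wedge !term -!(big_split, sumrB).
apply: eq_bigr => i _; rewrite -!(big_split, sumrB); apply: eq_bigr => j _ /=; ring.
Qed.

Lemma wedgeC al be : wedge al be = wedge be al.
Proof. by rewrite /wedge; ring. Qed.

Lemma wedgeZ (s t : R) al be :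
  wedge (fun k l => s * al k l) (fun k l => t * be k l) = s * t * wedge al be.
Proof. by rewrite /wedge; ring. Qed.

(** On skew matrices tr (M N) = -2 vee M . vee N; this links the Chern-Weil form to the sum of the
    squares of the F_i. *)
Lemma trace_wedge (Om : 'I_4 -> 'I_4 -> 'M[R]_3) :
  (forall k l, (Om k l)^T = - Om k l) ->
  \sum_i \sum_j wedge (fun k l => Om k l i j) (fun k l => Om k l j i) =
  - (2 * \sum_i wedge (fun k l => vee (Om k l) 0 i) (fun k l => vee (Om k l) 0 i)).
Proof.
move=> sO; rewrite !sum3.
have d k l := skew_diag (sO k l); have s k l := skewE (sO k l).
rewrite /wedge !veeE.
rewrite !(d _ _ _) .
(* Skewness turns every off-diagonal entry into one of those read by [vee], at (2,1), (0,2) and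
   (1,0). *)
rewrite !(s _ _ 1 2) !(s _ _ 2 0) !(s _ _ 0 1); ring.
Qed.

Lemma mulmx3E m n (a : 'M[R]_(m, 3)) (b : 'M[R]_(3, n)) i j :
  (a *m b) i j = a i 0 * b 0 j + a i 1 * b 1 j + a i 2 * b 2 j.
Proof. by rewrite mxE sum3. Qed.

Lemma mxtrace_hat (c d : 'rV[R]_3) :
  \tr (hat c *m hat d) = - (2 * (c *m d^T) 0 0).
Proof. by rewrite /mxtrace sum3 !mxE !sum3 !hatE !mxE; ring. Qed.

Lemma conj_skew M g : M^T = - M -> (g^T *m M *m g)^T = - (g^T *m M *m g).
Proof. by move=> sM; rewrite !trmx_mul trmxK sM mulmxA mulmxN mulNmx. Qed.

Lemma hat_skew (c : 'rV[R]_3) : (hat c)^T = - hat c.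
Proof. by apply/matrixP; apply: ord3P; apply: ord3P; rewrite mxE [RHS]mxE !hatE; ring. Qed.

(** Conjugation by an orthogonal matrix preserves tr (M N), which is -2 times the dot product under
    [vee]; hence it acts on the vectors [vee M] by an orthogonal matrix, whose rows are the images
    of the basis. *)
Lemma vee_conj g : g *m g^T = 1%:M ->
  exists2 P : 'M[R]_3, P^T *m P = 1%:M &
    forall M, M^T = - M -> vee (g^T *m M *m g) = vee M *m P.
Proof.
move=> gg; pose P := \matrix_i vee (g^T *m hat (delta_mx 0 i) *m g).
exists P => [|M sM].
  apply: mulmx1C; apply/matrixP => i j; apply: (@mulfI _ 2%:R) => //.
  transitivity (- \tr (hat (delta_mx 0 i) *m hat (delta_mx 0 j) : 'M[R]_3)); last first.
    by rewrite mxtrace_hat opprK trmx_delta mul_delta_mx_cond mulrb !mxE;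
      case: eqP; rewrite ?mxE.
  have -> : \tr (hat (delta_mx 0 i) *m hat (delta_mx 0 j) : 'M[R]_3) =
    \tr ((g^T *m hat (delta_mx 0 i) *m g) *m (g^T *m hat (delta_mx 0 j) *m g)).
    by rewrite -!mulmxA (mulmxA g g^T) gg mul1mx [RHS]mxtrace_mulC -!mulmxA gg mulmx1.
  rewrite -(hat_vee (conj_skew g (hat_skew (delta_mx 0 i)))).
  rewrite -(hat_vee (conj_skew g (hat_skew (delta_mx 0 j)))).
  rewrite mxtrace_hat opprK; congr (_ * _).
  by rewrite !mxE; apply: eq_bigr => k _; rewrite !mxE.
rewrite -[M in LHS]hat_vee//; move: (vee M) => c.
have PE i j : P i j = vee (g^T *m hat (delta_mx 0 i) *m g) 0 j by rewrite mxE.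
apply/rowP; apply: ord3P; rewrite mulmx3E !PE !veeE !mulmx3E !hatE !mxE /=; ring.
Qed.

(** The discriminant w^2 - a b is positive. The quadratic is the wedge square of F_i + t F_j, so
    opposite signs of two squares would produce a null form. *)
Lemma opposite_signs_root (a b w : R) : a * b < 0 ->
  exists t, a + 2 * t * w + t ^+ 2 * b = 0.
Proof.
move=> ab; exists ((Num.sqrt (w ^+ 2 - a * b) - w) / b).
have b0 : b != 0 by apply: contraTN ab => /eqP->; rewrite mulr0 ltxx.
have : Num.sqrt (w ^+ 2 - a * b) ^+ 2 = w ^+ 2 - a * b.
  by rewrite sqr_sqrtr// subr_ge0 (le_trans (ltW ab))// sqr_ge0.
move: (Num.sqrt _) => s h; apply: (mulfI b0); rewrite mulr0.
transitivity (a * b + s ^+ 2 - w ^+ 2); last by rewrite h; ring.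
by field.
Qed.

(** This is |W - 1|^2 = |W|^2 - 2 tr W + 3, for a symmetric [W] of trace 3. *)
Lemma trace_norm_ge (W : 'M[R]_3) : W^T = W -> \tr W = 3 ->
  \sum_i \sum_j W i j * W j i - 3 = \sum_i \sum_j (W i j - (i == j)%:R) ^+ 2.
Proof.
move=> sW tW.
have h i j : W i j = W j i by rewrite -[in LHS]sW mxE.
move: tW; rewrite /mxtrace !sum3 /= (h 1 0) (h 2 0) (h 2 1) => tW.
have -> : W 2 2 = 3 - W 0 0 - W 1 1 by lra.
ring.
Qed.

(* The rows of the dual form are in the kernel of a degenerate form. *)
Lemma degenerate_kernel al : (forall k l, al k l = - al l k) ->
  wedge al al = 0 -> exists2 u : 'rV[R]_4, u != 0 & forall l, \sum_k u 0 k * al k l = 0.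
Proof.
move=> sal w0.
have d k : al k k = 0 by have := sal k k; lra.
pose dual := [:: [:: 0; al 2 3; - al 1 3; al 1 2];
                 [:: - al 2 3; 0; al 0 3; - al 0 2];
                 [:: al 1 3; - al 0 3; 0; al 0 1];
                 [:: - al 1 2; al 0 2; - al 0 1; 0]].
pose D i : 'rV[R]_4 := \row_j (nth [::] dual i)`_j.
(* The Pfaffian, half of the wedge square. The product of the matrix [dual] with that of [al] is
   minus the Pfaffian times the identity. *)
have pf : al 0 1 * al 2 3 - al 0 2 * al 1 3 + al 0 3 * al 1 2 = 0.
  by move: w0; rewrite /wedge; lra.
have DK (i : 'I_4) l : \sum_k D i 0 k * al k l = 0.
  move: i l; apply: ord4P; apply: ord4P; rewrite sum4 !mxE /= ?d;
    rewrite ?(sal 1 0) ?(sal 2 0) ?(sal 3 0) ?(sal 2 1) ?(sal 3 1) ?(sal 3 2);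
    move: pf; lra.
have [/existsP[i Di]|] := boolP [exists i : 'I_4, D i != 0].
  by exists (D i) => // l; exact: DK.
rewrite negb_exists => /forallP D0.
have {}D0 (i j : 'I_4) : D i 0 j = 0 by have := D0 i; rewrite negbK => /eqP ->; rewrite mxE.
(* If the dual form vanishes, so does [al], and any nonzero vector is in its kernel. *)
exists (delta_mx 0 0); first by apply/eqP => /matrixP/(_ 0 0); rewrite !mxE /=; lra.
move=> l; rewrite (bigD1 0)//= big1 => [|k k0]; last by rewrite mxE (negPf k0) andbF mul0r.
rewrite mxE eqxx mul1r addr0; move: l; apply: ord4P; first exact: d.
- by have := D0 2 3; rewrite mxE.
- by have := D0 1 3; rewrite mxE /=; lra.
- by have := D0 1 2; rewrite mxE.
Qed.

(** * Definite triples of 2-forms *)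

Section DefiniteForms.
Variable F : 'I_3 -> 'I_4 -> 'I_4 -> R.
Hypothesis alt_F : forall i k l, F i k l = - F i l k.
Hypothesis definite_F : forall u v : 'rV[R]_4, free [:: u; v] ->
  exists i, \sum_k \sum_l u 0 k * v 0 l * F i k l != 0.

Let comb (c : 'rV[R]_3) k l := \sum_i c 0 i * F i k l.

(* If the form is degenerate, u spans its kernel, and the remaining two
   equations F_i(v, u) = 0 have a solution v independent of u. *)
Lemma wedge_comb_neq0 (c : 'rV[R]_3) : c != 0 -> wedge (comb c) (comb c) != 0.
Proof.
move=> c0; apply/eqP => /degenerate_kernel[k l|u u0 uc].
  by rewrite /comb -sumrN; apply: eq_bigr => i _; rewrite alt_F mulrN.
(* The columns of [M] are the 1-forms F_i(-, u), and a row vector [v] satisfies v M = 0 when all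
   F_i(v, u) vanish. Since [u] is in the kernel of the combination [c], these columns are linearly
   dependent. *)
pose M : 'M[R]_(4, 3) := \matrix_(k, i) \sum_l u 0 l * F i k l.
have Mc : M *m c^T = 0.
  apply/colP => k; transitivity (- \sum_l u 0 l * comb c l k); last by rewrite uc oppr0 mxE.
  rewrite mxE -sumrN.
  under eq_bigr do rewrite !mxE mulr_suml.
  rewrite exchange_big; apply: eq_bigr => l _ /=.
  rewrite /comb mulr_sumr -sumrN; apply: eq_bigr => i _.
  by rewrite alt_F; ring.
have rM : (\rank M <= 2)%N.
  have := mulmx0_rank_max Mc; rewrite mxrank_tr rank_rV c0; lia.
have rK : (2 <= \rank (kermx M))%N by rewrite mxrank_ker; lia.
(* The left kernel of [M] has dimension at least 2, so it is not contained in the line of [u]. *)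
have : ~~ (kermx M <= u)%MS.
  by apply: contraTN rK => /mxrankS; rewrite rank_rV u0; lia.
move=> /row_subPn[i]; set v := row i _ => vu.
have vM : v *m M = 0 by apply/sub_kermxP; rewrite row_sub.
have : free [:: v; u].
  rewrite free_cons seq1_free u0 andbT span_seq1; apply: contra vu => /vlineP[k ->].
  exact: scalemx_sub.
move=> /definite_F[j]/eqP; apply.
transitivity ((v *m M) 0 j); last by rewrite vM mxE.
rewrite [RHS]mxE; apply: eq_bigr => k _.
by rewrite !mxE mulr_sumr; apply: eq_bigr => l _; rewrite mulrA.
Qed.

(** No nonzero combination of the F_i has zero square. So each F_i /\ F_i is nonzero, and no two
    have opposite signs, as some F_i + t F_j would then be null. A sum of three nonzero numbers of
    one sign is nonzero. *)
Lemma trace_wedge_neq0 : \sum_i wedge (F i) (F i) != 0.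
Proof.
have comb2 i j (t : R) : i != j ->
    wedge (F i) (F i) + 2 * t * wedge (F i) (F j) + t ^+ 2 * wedge (F j) (F j) != 0.
  move=> ij; have := @wedge_comb_neq0 (delta_mx 0 i + t *: delta_mx 0 j).
  have -> : comb (delta_mx 0 i + t *: delta_mx 0 j) = fun k l => F i k l + t * F j k l.
    apply/funext => k; apply/funext => l; rewrite /comb (bigD1 i)//= (bigD1 j) 1?eq_sym//=.
    rewrite big1 => [|h /andP[hi hj]]; rewrite !mxE !eqxx.
      rewrite /= (negPf ij) (eq_sym j) (negPf ij) /=; ring.
    rewrite /= (negPf hi) (negPf hj) /=; ring.
  move=> h; rewrite (_ : _ + _ = wedge (fun k l => F i k l + t * F j k l)
                             (fun k l => F i k l + t * F j k l)).
    apply: h; apply/eqP => /matrixP/(_ 0 i); rewrite !mxE !eqxx (negPf ij) mulr0 addr0.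
    by apply/eqP; rewrite oner_eq0.
  by rewrite /wedge; ring.
have pos i j : i != j -> 0 < wedge (F i) (F i) * wedge (F j) (F j).
  move=> ij; rewrite ltNge le_eqVlt; apply/negP => /orP[|/opposite_signs_root].
    rewrite mulf_eq0 => /orP[]/eqP h.
      by have := comb2 i j 0 ij; rewrite h expr0n /= !(mulr0, mul0r) !addr0 eqxx.
    have := comb2 j i 0; rewrite eq_sym => /(_ ij).
    by rewrite h expr0n /= !(mulr0, mul0r) !addr0 eqxx.
  by move=> /(_ (wedge (F i) (F j)))[t h]; have := comb2 i j t ij; rewrite h eqxx.
have := pos 0 1 isT; have := pos 0 2 isT; rewrite sum3.
move: (wedge (F 0) (F 0)) (wedge (F 1) (F 1)) (wedge (F 2) (F 2)) => a b c ac ab.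
case: (ltgtP a 0) => a0; last by move: ab; rewrite a0 mul0r ltxx.
  by rewrite lt_eqF//; move: ab ac; rewrite !nmulr_rgt0//; lra.
by rewrite gt_eqF//; move: ab ac; rewrite !pmulr_rgt0//; lra.
Qed.

End DefiniteForms.

End Algebra.

(** * Integration of continuous functions on R^4 *)

Section Lebesgue4.
Context {R : realType}.
Implicit Types (U D K : set 'rV[R]_4) (h : 'rV[R]_4 -> R).

Let T1 := g_sigma_algebraType (R.-ocitv.-measurable : set (set (ocitv_type R))).
(* The domain of leb4, whose sigma-algebra is only convertible to the one
   inferred for R * R * R * R. *)
Let T4 := (T1 * T1 * T1 * T1)%type.

(** The norm of row vectors is the sup norm, so balls are cubes, whose measurability and volume
    follow from the product structure. *)
Lemma preimage_of_coords_ball (y : 'rV[R]_4) (r : R) : 0 < r ->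
  of_coords @^-1` ball y r =
  ball (y 0 0) r `*` ball (y 0 1) r `*` ball (y 0 2) r `*` ball (y 0 3) r.
Proof.
move=> r0; apply/seteqP; split=> -[[[p0 p1] p2] p3] /=.
- case=> _ h; have := h 0 0; have := h 0 1; have := h 0 2; have := h 0 3.
  by rewrite !mxE.
- case=> -[[h0 h1] h2] h3; split=> // i; rewrite ord1.
  by apply: ord4P; rewrite !mxE.
Qed.

Lemma measurable_preimage_ball (y : 'rV[R]_4) r : 0 < r ->
  measurable (of_coords @^-1` ball y r : set T4).
Proof.
move=> r0; rewrite preimage_of_coords_ball//.
have mb (x : R) : measurable (ball x r : set T1) by exact: measurable_ball.
by do 3 (apply: measurableX => //).
Qed.

Lemma leb4_box (A B C D : set T1) :
  measurable A -> measurable B -> measurable C -> measurable D ->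
  leb4 (A `*` B `*` C `*` D) = (lebesgue_measure A * lebesgue_measure B *
    lebesgue_measure C * lebesgue_measure D)%E.
Proof.
move=> mA mB mC mD; rewrite /leb4.
have m2 : measurable (A `*` B) by exact: measurableX.
have m3 : measurable (A `*` B `*` C) by exact: measurableX.
rewrite (product_measure1E _ _ m3 mD).
congr (_ * _)%E; apply: (etrans (product_measure1E _ _ m2 mC)).
congr (_ * _)%E; exact: (product_measure1E _ _ mA mB).
Qed.

Lemma leb4_ball (y : 'rV[R]_4) r : 0 < r ->
  leb4 (of_coords @^-1` ball y r) = ((r *+ 2) ^+ 4)%:E.
Proof.
move=> r0; rewrite preimage_of_coords_ball//.
have mb (x : R) : measurable (ball x r : set T1) by exact: measurable_ball.
rewrite leb4_box// !lebesgue_measure_ball ?ltW// -!EFinM; congr (_%:E).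
by rewrite !exprS expr0 mulr1 !mulrA.
Qed.

Lemma rational_ball U (y : 'rV[R]_4) : open U -> U y ->
  exists q : 'rV[rat]_4 * rat, [/\ (0 < q.2)%R,
    ball (map_mx ratr q.1 : 'rV[R]_4) (ratr q.2) y &
    ball (map_mx ratr q.1 : 'rV[R]_4) (ratr q.2) `<=` U].
Proof.
move=> oU Uy; have /nbhs_ballP[e /= e0 eU] : nbhs y U by exact: open_nbhs_nbhs.
(* A radius below e / 2 suffices: a ball of radius r whose centre is within r of [y] lies in the
   ball of radius 2 r < e about [y]. *)
have [r /andP[r0 re]] : exists r : rat, 0 < (ratr r : R) < e / 2.
  have := @rat_in_itvoo R 0 (e / 2) _; rewrite divr_gt0// => /(_ isT)[r].
  by rewrite in_itv /=; exists r.
have /choice[q qP] : forall i : 'I_4, exists q : rat, ball (ratr q : R) (ratr r) (y 0 i).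
  move=> i; have [|q] := @rat_in_itvoo R (y 0 i - ratr r) (y 0 i + ratr r) _.
    by rewrite ltrBlDr -addrA ltrDl addr_gt0.
  rewrite in_itv /= => /andP[h1 h2]; exists q; rewrite /ball /= ltr_norml; lra.
exists (\row_i q i, r); split => /=.
- by move: r0; rewrite ltr0q.
- by split=> // i j; rewrite ord1 !mxE; exact: qP.
- move=> z [_ hz]; apply: eU; split=> // i j; rewrite ord1.
  have := hz 0 j; have := qP j; rewrite !mxE /ball /= => /ltr_normlP[h1 h2] /ltr_normlP[h3 h4].
  by rewrite ltr_norml; lra.
Qed.

(** An open set is the union of the balls with rational centre and radius that it contains; they are
    countably many, and their preimages are cubes. *)
Lemma measurable_preimage_open U : open U -> measurable (of_coords @^-1` U : set T4).
Proof.
move=> oU.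
pose B (q : 'rV[rat]_4 * rat) := ball (map_mx ratr q.1 : 'rV[R]_4) (ratr q.2).
rewrite (_ : _ @^-1` U = \bigcup_q
    (if `[< (0 < q.2)%R /\ B q `<=` U >] then of_coords @^-1` B q else set0)).
  apply: countable_bigcupT_measurable => [|q]; first exact: countableP.
  by case: asboolP => [[q0 _]|_//]; apply: measurable_preimage_ball; rewrite ltr0q.
apply/seteqP; split=> p /= => [Up|[q _]].
  have [q [q0 qp qU]] := rational_ball oU Up.
  by exists q => //; case: asboolP => // -[].
by case: asboolP => // -[_ qU] qp; exact: qU.
Qed.

Lemma measurable_continuous D h : open D -> (forall y, D y -> {for y, continuous h}) ->
  measurable_fun (of_coords @^-1` D : set T4) (h \o of_coords).
Proof.
move=> oD ch mD; apply: (measurability _ (RGenOpens.measurableE R)).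
move=> _ [_ [a [b ->] <-]].
rewrite (_ : _ `&` _ = of_coords @^-1` (D `&` h @^-1` `]a, b[%classic)); last by [].
  apply: measurable_preimage_open; rewrite openE => y [Dy hy].
  apply: filterI; first exact: open_nbhs_nbhs.
  by apply: ch => //; apply: open_nbhs_nbhs; split=> //; exact: interval_open.
exact: mD.
Qed.

Variables (D K : set 'rV[R]_4) (h : 'rV[R]_4 -> R).
Hypotheses (oD : open D) (cK : compact K) (KD : K `<=` D).
Hypothesis ch : forall y, D y -> {for y, continuous h}.
Hypothesis h0 : forall y, D y -> ~ K y -> h y = 0.

(** On [D], which may have infinite measure, [h] vanishes outside [K]; it is bounded by compactness
    of [K], and [K] lies in a ball, of finite measure. *)
Lemma integrable_continuous :
  leb4.-integrable (of_coords @^-1` D) (EFin \o (h \o of_coords)).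
Proof.
have mh : measurable_fun (of_coords @^-1` D : set T4) (h \o of_coords).
  exact: measurable_continuous.
have [M M0 hM] : exists2 M, 0 <= M & forall y, D y -> `|h y| <= M.
  have : compact (h @` K).
    apply: continuous_compact => //; apply: continuous_in_subspaceT => y.
    by rewrite inE => /KD; exact: ch.
  move=> /compact_bounded[M [_ MP]].
  exists (`|M| + 1) => [|y Dy]; first by rewrite addr_ge0.
  have [Ky|nK] := pselect (K y); last by rewrite h0// normr0 addr_ge0.
  by apply: (MP (`|M| + 1)); [rewrite ltr_pwDr// ler_norm|exists y].
have [r r0 Kr] : exists2 r, 0 < r & K `<=` ball 0 r.
  have [N [_ NP]] := compact_bounded cK.
  (* [compact_bounded] bounds the norm by any number strictly above [N], here |N| + 1; one more unit
     makes the bound strict, as the open ball requires. *)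
  have N0 : 0 < `|N| + 2 by rewrite ltr_wpDl.
  exists (`|N| + 2) => // y Ky; rewrite -ball_normE /= sub0r normrN.
  apply: (@le_lt_trans _ _ (`|N| + 1)); last by rewrite ltrD2l ltr1n.
  by apply: (NP (`|N| + 1)) => //; rewrite ltr_pwDr// ler_norm.
have mB := measurable_preimage_ball 0 r0.
have mD := measurable_preimage_open oD.
apply/integrableP; split; first exact/measurable_EFinP.
apply: (@le_lt_trans _ _ (\int[leb4]_(p in of_coords @^-1` D)
   (M%:E * (\1_(of_coords @^-1` ball 0 r) p)%:E)))%E.
  apply: ge0_le_integral => //.
  - by apply: measurableT_comp => //; exact/measurable_EFinP.
  - by apply/measurable_EFinP/measurable_funM => //; exact: measurable_indic.
  - move=> p Dp /=; rewrite -EFinM lee_fin indicE.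
    have [Kp|nK] := pselect (K (of_coords p)).
      rewrite mem_set ?mulr1; [exact: hM|exact: Kr].
    by rewrite h0// normr0 mulr_ge0.
rewrite ge0_integralZl//; last exact/measurable_EFinP/measurable_indic.
rewrite integral_indic//; apply: lte_mul_pinfty => //.
apply: (@le_lt_trans _ _ (leb4 (of_coords @^-1` ball 0 r))).
  by apply: le_measure; rewrite ?inE//; exact: measurableI.
by rewrite leb4_ball// ltry.
Qed.

(** If h y > 0, then h >= h y / 2 on some ball about [y] inside [D], and this ball has positive
    measure. *)
Lemma integral_continuous_eq0 : (forall y, D y -> 0 <= h y) ->
  \int[leb4]_(p in of_coords @^-1` D) h (of_coords p) = 0 ->
  forall y, D y -> h y = 0.
Proof.
move=> hp hi y Dy; apply: contrapT => /eqP hy.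
have {}hy : 0 < h y by rewrite lt_def hy hp.
have [r r0 hr] : exists2 r, 0 < r & ball y r `<=` D `&` [set z | h y / 2 <= h z].
  have : nbhs y (D `&` [set z | h y / 2 <= h z]).
    apply: filterI; first exact: open_nbhs_nbhs.
    have : \forall z \near y, h y / 2 < h z.
      have /cvgr_gt : h z @[z --> y] --> h y := ch Dy.
      by apply; rewrite ltr_pdivrMr// ltr_pMr// ltr1n.
    by apply: filterS => z /ltW.
  by move=> /nbhs_ballP[r /= r0 rP]; exists r.
have mB := measurable_preimage_ball y r0.
have mD := measurable_preimage_open oD.
have int := integrable_continuous.
have mh := measurable_continuous oD ch.
(* The real integral is the [fine] of the extended one, and [fine] sends infinite values to 0 as
   well; integrability rules these out. *)
have: (\int[leb4]_(p in of_coords @^-1` D) (h (of_coords p))%:E = 0)%E.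
  rewrite -[LHS]fineK ?[fine _]hi//; exact: integrable_fin_num.
apply/eqP; rewrite gt_eqF//.
apply: (@lt_le_trans _ _ (\int[leb4]_(p in of_coords @^-1` ball y r) (h y / 2)%:E))%E.
  rewrite integral_cst//; apply: mule_gt0; first by rewrite lte_fin divr_gt0.
  suff : (0 < leb4 (of_coords @^-1` ball y r))%E by [].
  by rewrite leb4_ball// lte_fin exprn_gt0// mulrn_wgt0.
apply: (@le_trans _ _ (\int[leb4]_(p in of_coords @^-1` ball y r) (h (of_coords p))%:E))%E.
  apply: ge0_le_integral => //.
  - by move=> p _; rewrite lee_fin divr_ge0// ltW.
  - apply/measurable_EFinP; apply: measurable_funS mh => //.
    by move=> p /hr[].
  - by move=> p /hr[_]; rewrite lee_fin.
apply: ge0_subset_integral => //.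
- exact/measurable_EFinP.
- by move=> p Dp; rewrite lee_fin hp.
- by move=> p /hr[].
Qed.

End Lebesgue4.

(** * Symmetry of second derivatives *)

Section Schwarz.
Context {R : realType} {V : normedModType R}.
Implicit Types (f : V -> R) (u v y z : V).

Lemma is_derive_line f u z (t : R) : derivable f (t *: u + z) u ->
  is_derive t 1 (fun s : R => f (s *: u + z)) ('D_u f (t *: u + z)).
Proof.
have E : (fun h : R => h^-1 *: (f ((h *: (1 : R) + t) *: u + z) - f (t *: u + z))) =
    (fun h : R => h^-1 *: (f (h *: u + (t *: u + z)) - f (t *: u + z))).
  by apply/funext => h; rewrite scalerDl /GRing.scale /= mulr1 addrA.
by move=> df; split; rewrite /derivable /derive /= E.
Qed.

(** The mean value theorem is applied twice: to the increment of [f] along [v], as a function of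
    [s], then to the derivative of [f] along [u], as a function of [t]. *)
Lemma mixed_difference f u v y (h : R) : 0 < h ->
  (forall s t, 0 <= s <= h -> 0 <= t <= h ->
    derivable f (s *: u + t *: v + y) u /\
    derivable ('D_u f) (s *: u + t *: v + y) v) ->
  exists s t, [/\ 0 <= s <= h, 0 <= t <= h &
    f (h *: u + h *: v + y) - f (h *: u + y) - (f (h *: v + y) - f y) =
    'D_v ('D_u f) (s *: u + t *: v + y) * h ^+ 2].
Proof.
move=> h0 df.
have hh : 0 <= h <= h by rewrite lexx ltW.
have h00 : 0 <= (0 : R) <= h by rewrite lexx ltW.
pose g (s : R) := f (s *: u + (h *: v + y)) - f (s *: u + y).
have dg s : s \in `[0, h] -> is_derive s 1 g
    ('D_u f (s *: u + (h *: v + y)) - 'D_u f (s *: u + y)).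
  rewrite in_itv /= => hs; apply: is_deriveB; apply: is_derive_line.
    by rewrite addrA; have [] := df s h hs hh.
  by have [] := df s 0 hs h00; rewrite scale0r addr0.
have [c hc gE] := @MVT_segment _ g _ 0 h (ltW h0)
  (fun x hx => dg x (subset_itv_oo_cc hx)) (derivable_within_continuous
  (fun x hx => @ex_derive _ _ _ _ _ _ _ (dg x hx))).
pose k (t : R) := 'D_u f (t *: v + (c *: u + y)).
have hc' : 0 <= c <= h by move: hc; rewrite in_itv.
have dk t : t \in `[0, h] -> is_derive t 1 k ('D_v ('D_u f) (t *: v + (c *: u + y))).
  rewrite in_itv /= => ht; apply: is_derive_line.
  by rewrite addrCA addrA; have [] := df c t hc' ht.
have [d hd kE] := @MVT_segment _ k _ 0 h (ltW h0)
  (fun x hx => dk x (subset_itv_oo_cc hx)) (derivable_within_continuous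
  (fun x hx => @ex_derive _ _ _ _ _ _ _ (dk x hx))).
exists c, d; split=> //.
move: gE; rewrite /g !scale0r !add0r subr0 addrA => ->.
have -> : c *: u + (h *: v + y) = h *: v + (c *: u + y) by rewrite addrCA.
move: kE; rewrite /k scale0r add0r subr0 => ->.
by rewrite addrCA addrA; ring.
Qed.

(** The second difference of [f] is symmetric in [u] and [v]. By [mixed_difference] it equals h^2
    times either mixed derivative, at two points near [y]; continuity then forbids different values
    at [y]. *)
Lemma derive_comm f u v y :
  (\forall z \near y, [/\ derivable f z u, derivable f z v,
     derivable ('D_u f) z v & derivable ('D_v f) z u]) ->
  {for y, continuous ('D_v ('D_u f))} -> {for y, continuous ('D_u ('D_v f))} ->
  'D_v ('D_u f) y = 'D_u ('D_v f) y.
Proof.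
move=> df c1 c2; apply: contrapT => /eqP neq.
set D1 := 'D_v ('D_u f) in c1 neq *; set D2 := 'D_u ('D_v f) in c2 neq *.
pose e := `|D1 y - D2 y| / 2.
have e0 : 0 < e by rewrite divr_gt0// normr_gt0 subr_eq0.
have n1 : \forall z \near y, `|D1 y - D1 z| < e.
  by have /cvgrPdist_lt := c1 : D1 z @[z --> y] --> D1 y; apply.
have n2 : \forall z \near y, `|D2 y - D2 z| < e.
  by have /cvgrPdist_lt := c2 : D2 z @[z --> y] --> D2 y; apply.
have [r /= r0 rP] := (nbhs_ballP _ _).1 (filterI df (filterI n1 n2)).
(* This keeps the parallelogram spanned by h u and h v at [y] inside the ball; the 1 makes the
   denominator positive and the estimate strict. *)
pose h := r / (1 + `|u| + `|v|).
have p0 : 0 < 1 + `|u| + `|v| by rewrite -addrA ltr_pwDl// addr_ge0.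
have h0 : 0 < h by rewrite divr_gt0.
have hP s t : 0 <= s <= h -> 0 <= t <= h -> ball y r (s *: u + t *: v + y).
  move=> /andP[s0 sh] /andP[t0 th]; rewrite -ball_normE /= distrC addrK.
  apply: (@le_lt_trans _ _ (h * (`|u| + `|v|))).
    rewrite (le_trans (ler_normD _ _))// !normrZ !ger0_norm// mulrDr lerD//;
      exact: ler_wpM2r.
  by rewrite -[ltRHS](divfK (lt0r_neq0 p0)) -/h ltr_pM2l// -addrA ltr_pwDl.
have [s1 [t1 [hs1 ht1 E1]]] := @mixed_difference f u v y h h0
  (fun s t hs ht => let: conj (And4 a _ c _) _ := rP _ (hP s t hs ht) in conj a c).
have hP' s t : 0 <= s <= h -> 0 <= t <= h -> ball y r (s *: v + t *: u + y).
  by move=> hs ht; rewrite (addrC (s *: v)); exact: hP.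
have [s2 [t2 [hs2 ht2 E2]]] := @mixed_difference f v u y h h0
  (fun s t hs ht => let: conj (And4 _ b _ d) _ := rP _ (hP' s t hs ht) in conj b d).
have : D1 (s1 *: u + t1 *: v + y) = D2 (s2 *: v + t2 *: u + y).
  apply: (@mulIf _ (h ^+ 2)); first by rewrite expf_neq0// gt_eqF.
  rewrite -E1 -E2 (addrC (h *: v) (h *: u)).
  have swap (p q r' s : R) : p - q - (r' - s) = p - r' - (q - s) by ring.
  exact: swap.
have [_ [/= b1 _]] := rP _ (hP _ _ hs1 ht1).
have [_ [/= _ b2]] := rP _ (hP' _ _ hs2 ht2).
move=> E; clearbody D1 D2; have : `|D1 y - D2 y| < e + e.
  apply: (le_lt_trans (ler_distD (D1 (s1 *: u + t1 *: v + y)) (D1 y) (D2 y))).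
  by apply: ltrD; [exact: b1|rewrite E distrC; exact: b2].
by rewrite /e -splitr ltxx.
Qed.

End Schwarz.

(** * Smooth functions of four variables and the chain rule *)

Section Smooth.
Context {R : realType}.
Implicit Types (f : 'rV[R]_4 -> R) (U : set 'rV[R]_4).

Lemma smooth_onS U U' f : U' `<=` U -> smooth_on U f -> smooth_on U' f.
Proof. by move=> UU sf s y /UU; exact: sf. Qed.

Lemma smooth_on_differentiable U f y : smooth_on U f -> U y -> differentiable f y.
Proof. by move=> sf; exact: (sf [::]). Qed.

Lemma smooth_on_partial U f k : smooth_on U f -> smooth_on U (partial k f).
Proof.
by move=> sf s y Uy; have := sf (rcons s k) y Uy; rewrite foldr_rcons.
Qed.

Lemma partialC U f k l y : open U -> smooth_on U f -> U y ->
  partial k (partial l f) y = partial l (partial k f) y.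
Proof.
move=> oU sf Uy; apply: derive_comm.
- have : nbhs y U by exact: open_nbhs_nbhs.
  apply: filterS => z Uz.
  split; apply: diff_derivable; first exact: (sf [::]).
  + exact: (sf [::]).
  + exact: (sf [:: l]).
  + exact: (sf [:: k]).
- exact/differentiable_continuous/(sf [:: k; l]).
- exact/differentiable_continuous/(sf [:: l; k]).
Qed.

Lemma differentiable_row (phi : 'rV[R]_4 -> 'rV[R]_4) y :
  (forall p, differentiable (fun z => phi z 0 p) y) -> differentiable phi y.
Proof.
move=> dphi.
rewrite (_ : phi = \sum_(p < 4) fun z => phi z 0 p *: (delta_mx 0 p : 'rV[R]_4)).
  by apply: differentiable_sum => p; exact: differentiableZl.
by apply/funext => z; rewrite fct_sumE -row_sum_delta.
Qed.

Lemma partial_comp (phi : 'rV[R]_4 -> 'rV[R]_4) f y k :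
  (forall p, differentiable (fun z => phi z 0 p) y) ->
  differentiable f (phi y) ->
  partial k (fun z => f (phi z)) y =
  \sum_p partial k (fun z => phi z 0 p) y * partial p f (phi y).
Proof.
move=> dphi df; have dp := differentiable_row dphi.
have Ed : 'd phi y (delta_mx 0 k) = \row_p partial k (fun z => phi z 0 p) y.
  rewrite -deriveE// derive_mx; last exact: diff_derivable.
  by apply/rowP => p; rewrite !mxE.
rewrite {1}/partial (deriveE _ (differentiable_comp dp df)) diff_comp//=.
rewrite Ed [X in 'd _ _ X]row_sum_delta linear_sum; apply: eq_bigr => p _.
by rewrite linearZ /= mxE [partial p f _](deriveE _ df).
Qed.

Lemma partial_near f f' k y : (\forall z \near y, f z = f' z) ->
  partial k f y = partial k f' y.
Proof. by move=> ff; apply: near_eq_derive. Qed.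

End Smooth.

(** * Differential calculus of matrix-valued functions *)

Section MatrixPartial.
Context {R : realType} {n : nat}.
Implicit Types (M N : 'rV[R]_4 -> 'M[R]_n) (y : 'rV[R]_4) (c : 'rV[R]_4 -> R).

Definition mx_partial (k : 'I_4) M y : 'M[R]_n :=
  \matrix_(i, j) partial k (fun z => M z i j) y.

Definition mx_differentiable M y := forall i j, differentiable (fun z => M z i j) y.

Lemma mx_partial_near M N k y : (\forall z \near y, M z = N z) ->
  mx_partial k M y = mx_partial k N y.
Proof.
move=> MN; apply/matrixP => i j; rewrite !mxE; apply: partial_near.
by apply: filterS MN => z ->.
Qed.

Lemma mx_partialD M N k y : mx_differentiable M y -> mx_differentiable N y ->
  mx_partial k (fun z => M z + N z) y = mx_partial k M y + mx_partial k N y.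
Proof.
move=> dM dN; apply/matrixP => i j; rewrite !mxE.
rewrite (_ : (fun z => _) = (fun z => M z i j) \+ (fun z => N z i j)).
  by rewrite /partial deriveD//; exact: diff_derivable.
by apply/funext => z; rewrite mxE.
Qed.

Lemma mx_differentiableM M N y : mx_differentiable M y -> mx_differentiable N y ->
  mx_differentiable (fun z => M z *m N z) y.
Proof.
move=> dM dN i j.
rewrite (_ : (fun z => _) = \sum_(h < n) ((fun z => M z i h) * (fun z => N z h j))).
  by apply: differentiable_sum => h; exact: differentiableM.
by apply/funext => z; rewrite mxE fct_sumE.
Qed.

Lemma mx_partialM M N k y : mx_differentiable M y -> mx_differentiable N y ->
  mx_partial k (fun z => M z *m N z) y = mx_partial k M y *m N y + M y *m mx_partial k N y.
Proof.
move=> dM dN; apply/matrixP => i j; rewrite !mxE.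
rewrite (_ : (fun z => _) = \sum_(h < n) ((fun z => M z i h) * (fun z => N z h j))).
  rewrite /partial derive_sum => [|h]; last by apply/diff_derivable/differentiableM.
  rewrite -big_split; apply: eq_bigr => h _ /=.
  rewrite deriveM; [|exact: diff_derivable..].
  by rewrite !mxE addrC; congr (_ + _); rewrite mulrC.
by apply/funext => z; rewrite mxE fct_sumE.
Qed.

Lemma mx_differentiable_sumZ (c : 'I_4 -> 'rV[R]_4 -> R) (M : 'I_4 -> 'rV[R]_4 -> 'M[R]_n) y :
  (forall p, differentiable (c p) y) -> (forall p, mx_differentiable (M p) y) ->
  mx_differentiable (fun z => \sum_p c p z *: M p z) y.
Proof.
move=> dc dM i j.
rewrite (_ : (fun z => _) = \sum_(p < 4) (c p * (fun z => M p z i j))).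
  by apply: differentiable_sum => h; apply: differentiableM; [exact: dc|exact: dM].
by apply/funext => z; rewrite summxE fct_sumE; apply: eq_bigr => p _; rewrite mxE.
Qed.

Lemma mx_partial_sumZ (c : 'I_4 -> 'rV[R]_4 -> R) (M : 'I_4 -> 'rV[R]_4 -> 'M[R]_n) k y :
  (forall p, differentiable (c p) y) -> (forall p, mx_differentiable (M p) y) ->
  mx_partial k (fun z => \sum_p c p z *: M p z) y =
  \sum_p (partial k (c p) y *: M p y + c p y *: mx_partial k (M p) y).
Proof.
move=> dc dM; apply/matrixP => i j; rewrite summxE mxE.
rewrite (_ : (fun z => _) = \sum_(p < 4) (c p * (fun z => M p z i j))).
  rewrite /partial derive_sum => [|h]; last first.
    by apply/diff_derivable/differentiableM; [exact: dc|exact: dM].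
  apply: eq_bigr => p _; rewrite deriveM; [|exact/diff_derivable/dc|exact/diff_derivable/dM].
  by rewrite !mxE addrC; congr (_ + _); rewrite mulrC.
by apply/funext => z; rewrite summxE fct_sumE; apply: eq_bigr => p _; rewrite mxE.
Qed.

Lemma mx_differentiable_comp (phi : 'rV[R]_4 -> 'rV[R]_4) M y :
  (forall p, differentiable (fun z => phi z 0 p) y) ->
  mx_differentiable M (phi y) -> mx_differentiable (fun z => M (phi z)) y.
Proof. by move=> /differentiable_row dp dM i j; exact: (differentiable_comp dp (dM i j)). Qed.

Lemma mx_partial_comp (phi : 'rV[R]_4 -> 'rV[R]_4) M y k :
  (forall p, differentiable (fun z => phi z 0 p) y) -> mx_differentiable M (phi y) ->
  mx_partial k (fun z => M (phi z)) y =
  \sum_p partial k (fun z => phi z 0 p) y *: mx_partial p M (phi y).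
Proof.
move=> dphi dM; apply/matrixP => i j; rewrite mxE summxE (partial_comp _ dphi (dM i j)).
by apply: eq_bigr => p _; rewrite !mxE.
Qed.

(* Equating the derivatives of both sides of g B_k = A_k g + d_k g, with H the
   common value of the mixed second derivatives of g. *)
Lemma gauge_curvature (g gk gl H Ak Al Bk Bl dkAl dlAk dkBl dlBk : 'M[R]_n) :
  g *m Bk = Ak *m g + gk -> g *m Bl = Al *m g + gl ->
  gk *m Bl + g *m dkBl = dkAl *m g + Al *m gk + H ->
  gl *m Bk + g *m dlBk = dlAk *m g + Ak *m gl + H ->
  g *m (dkBl - dlBk + (Bk *m Bl - Bl *m Bk)) =
  (dkAl - dlAk + (Ak *m Al - Al *m Ak)) *m g.
Proof.
move=> ek el ekl elk.
rewrite mulmxDr !mulmxBr mulmxDl !mulmxBl !(mulmxA g) ek el !mulmxDl -!(mulmxA _ g) ek el.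
rewrite !mulmxDr !mulmxA.
rewrite (_ : g *m dkBl = dkAl *m g + Al *m gk + H - gk *m Bl); last first.
  by rewrite -ekl addrAC subrr add0r.
rewrite (_ : g *m dlBk = dlAk *m g + Ak *m gl + H - gl *m Bk); last first.
  by rewrite -elk addrAC subrr add0r.
move: (dkAl *m g) (Al *m gk) (gk *m Bl) (dlAk *m g) (Ak *m gl) (gl *m Bk)
  (Ak *m Al *m g) (Al *m Ak *m g) => a1 a2 a3 a4 a5 a6 a7 a8.
apply/matrixP => i j; rewrite !mxE; ring.
Qed.

(** Curvature commutes with pullback by a map phi. Here [u] and [v] stand for the derivatives of phi
    along [k] and [l], [h] for its second derivatives, [B] for the connection and [D p q] for d_p
    B_q. By symmetry the same [h] occurs in both derivative terms and cancels. *)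
Lemma sum_scale_curvature (u v h : 'I_4 -> R) (B : 'I_4 -> 'M[R]_n)
    (D : 'I_4 -> 'I_4 -> 'M[R]_n) :
  \sum_p \sum_q (u p * v q) *: (D p q - D q p + (B p *m B q - B q *m B p)) =
  \sum_r (h r *: B r + v r *: \sum_s u s *: D s r)
  - \sum_r (h r *: B r + u r *: \sum_s v s *: D s r)
  + ((\sum_p u p *: B p) *m (\sum_q v q *: B q)
     - (\sum_p v p *: B p) *m (\sum_q u q *: B q)).
Proof.
pose S (Y : 'I_4 -> 'I_4 -> 'M[R]_n) := \sum_p \sum_q (u p * v q) *: Y p q.
have prod w w' : (\sum_p w p *: B p) *m (\sum_q w' q *: B q) =
    \sum_p \sum_q (w p * w' q) *: (B p *m B q).
  rewrite mulmx_suml; apply: eq_bigr => p _; rewrite mulmx_sumr; apply: eq_bigr => q _.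
  by rewrite -scalemxAl -scalemxAr scalerA.
have uvC (Y : 'I_4 -> 'I_4 -> 'M[R]_n) :
    \sum_p \sum_q (v p * u q) *: Y p q = S (fun p q => Y q p).
  by rewrite exchange_big; do 2 (apply: eq_bigr => ? _); rewrite mulrC.
have nest w w' : \sum_r w r *: (\sum_s w' s *: D s r) =
    \sum_p \sum_q (w' p * w q) *: D p q.
  rewrite exchange_big; apply: eq_bigr => r _; rewrite scaler_sumr.
  by apply: eq_bigr => s _; rewrite scalerA mulrC.
rewrite !prod uvC !big_split /= !nest uvC.
rewrite [X in _ = X - _ + _]addrC addrKA /S.
rewrite -!sumrB -!big_split; apply: eq_bigr => p _ /=.
rewrite -!sumrB -!big_split; apply: eq_bigr => q _ /=.
by rewrite scalerDr !scalerBr.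
Qed.

End MatrixPartial.

(** * Curvature in different frames *)

Section Covariance.
Context {R : realType} {X : compact_manifold4 R} {E : so3_bundle X}.
Variable A : metric_connection E.
Implicit Types (a b : triv_idx E) (y : 'rV[R]_4).

Lemma icoordK a (x : X) : triv_dom a x -> icoord a (coord a x) = x.
Proof. by move=> /triv_dom_chart; exact: chartK. Qed.

(** Near a point of it, the image of [W] contains the intersection of the open image of the chart
    with the preimage of [W] under the continuous inverse chart. *)
Lemma coord_im_open a (W : set X) : open W -> W `<=` triv_dom a -> open (coord a @` W).
Proof.
move=> oW Wa; rewrite openE => _ [x Wx <-].
have cx : chart_dom (triv_chart a) x by exact/triv_dom_chart/Wa.
have im : nbhs (coord a x) (coord a @` chart_dom (triv_chart a)).
  by apply: open_nbhs_nbhs; split; [exact: chart_im_open|exists x].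
have : nbhs (coord a x) (icoord a @^-1` W).
  apply: (@ichart_continuous _ X (triv_chart a)); first by exists x.
  rewrite -[ichart _ _]/(icoord a (coord a x)) icoordK; last exact: Wa.
  exact: open_nbhs_nbhs.
rewrite /interior => Wn; apply: filterS (filterI im Wn) => _ [[x' cx' <-] /=].
by rewrite /icoord /coord chartK//; exists x'.
Qed.

Lemma coord_dom_open a : open (coord_dom a).
Proof. by apply: coord_im_open; [exact: triv_dom_open|]. Qed.

Lemma curvatureE a y k l i j : curvature A a y k l i j =
  partial k (fun z => conn A a z l i j) y - partial l (fun z => conn A a z k i j) y
  + lie_bracket (conn A a y k) (conn A a y l) i j.
Proof. by rewrite /curvature mxE; congr (_ + _); rewrite !mxE. Qed.

Lemma curvature_anti a y k l : curvature A a y k l = - curvature A a y l k.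
Proof.
rewrite /curvature /lie_bracket !opprD !opprK.
by rewrite (addrC (- _) (\matrix_(i, j) partial k _ y)) (addrC (- (_ *m _))).
Qed.

Lemma curvature_skew a y k l : coord_dom a y ->
  (curvature A a y k l)^T = - curvature A a y k l.
Proof.
move=> Dy.
have sk p q i j : partial p (fun z => conn A a z q i j) y =
    - partial p (fun z => conn A a z q j i) y.
  rewrite -[RHS](@deriveN _ _ _ (fun z => conn A a z q j i)); last first.
    exact/diff_derivable/(smooth_on_differentiable (conn_smooth A q j i) Dy).
  (* Skewness of the connection matrices is known on [coord_dom a] only; as this set is open, it can
     be differentiated. *)
  have nD : nbhs y (coord_dom a) by apply: open_nbhs_nbhs; split=> //; exact: coord_dom_open.
  apply: partial_near; apply: filterS nD => z Dz.
  by rewrite (skewE (conn_skew A q Dz)).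
apply/matrixP => i j; rewrite mxE [RHS]mxE !curvatureE !lie_bracketE (sk k) (sk l).
have s q := skewE (conn_skew A q Dy).
rewrite !(s k j) !(s l j) !(s k _ i) !(s l _ i); ring.
Qed.

Section Change.
Variables (a b : triv_idx E).
Let V := coord b @` (triv_dom a `&` triv_dom b).
Let phi := coord_change a b.
Let g := transition a b.

Let oV : open V.
Proof.
by apply: coord_im_open => [|x []//]; apply: openI; exact: triv_dom_open.
Qed.

Let VD y : V y -> coord_dom b y.
Proof. by move=> [x [_ xb] <-]; exists x. Qed.

Let phiD y : V y -> coord_dom a (phi y).
Proof. by move=> [x [xa xb] <-]; exists x => //; rewrite /phi /coord_change icoordK. Qed.

Let phi_smooth p : smooth_on V (fun z => phi z 0 p).
Proof.
apply: smooth_onS; last exact: (@chart_smooth _ X (triv_chart a) (triv_chart b) p).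
by move=> _ [x [xa xb] <-]; exists x => //; split; exact: triv_dom_chart.
Qed.

Let g_smooth i j : smooth_on V (fun z => g z i j).
Proof.
have := @frame_smooth _ _ E a b i j; congr smooth_on.
by apply/funext => z; rewrite mxE.
Qed.

(** The columns of [g] are the coordinates, in one orthonormal frame, of the vectors of another. *)
Let gg y : V y -> g y *m (g y)^T = 1%:M.
Proof.
move=> [x [xa xb] <-]; apply: mulmx1C; apply/matrixP => i j.
rewrite !mxE -(frame_orthonormal xb i j).
rewrite [in RHS](frame_basis xa (frame b x i)).
have innerS (I : Type) (r : seq I) (c : I -> R) (u : I -> fibre E x) w :
    inner (\sum_(i <- r) c i *: u i) w = \sum_(i <- r) c i * inner (u i) w.
  elim: r => [|h r IH]; last by rewrite !big_cons innerDl IH.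
  rewrite !big_nil; have := innerDl 0 (0 : fibre E x) 0 w.
  by rewrite scaler0 addr0 mul0r add0r; have := innerDl 1 (0 : fibre E x) 0 w;
     rewrite scaler0 addr0 mul1r => /eqP; rewrite -subr_eq subrr eq_sym => /eqP.
rewrite innerS; apply: eq_bigr => h _; rewrite !mxE icoordK//.
Qed.

Lemma transition_orthogonal y : V y -> g y *m (g y)^T = 1%:M.
Proof. exact: gg. Qed.

(** The pullback of the connection matrices of [a] to the coordinates of [b], still in the frame
    [a]. *)
Let Ahat k z := \sum_p partial k (fun w => phi w 0 p) z *: conn A a (phi z) p.

(** Multiplication by [g] removes the transpose from the transition law, so that only [g] itself has
    to be differentiated below. *)
Let g_conn k y : V y -> g y *m conn A b y k = Ahat k y *m g y + mx_partial k g y.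
Proof.
move=> Vy; rewrite (conn_transition A k Vy) mulmxDr !mulmxA gg// !mul1mx //.
Qed.

(** Differentiating [g_conn] and antisymmetrising gives g F^b = F g, with F the curvature of the
    pulled-back connection [Ahat]; [sum_scale_curvature] then identifies F with the pullback of the
    curvature in [a]. *)
Lemma curvature_transition y k l : V y ->
  curvature A b y k l = (g y)^T *m
    (\sum_p \sum_q (partial k (fun z => phi z 0 p) y * partial l (fun z => phi z 0 q) y)
       *: curvature A a (phi y) p q) *m g y.
Proof.
move=> Vy; have nV : nbhs y V by exact: open_nbhs_nbhs.
have dphi p : differentiable (fun z => phi z 0 p) y.
  by exact: smooth_on_differentiable (phi_smooth p) Vy.
have dconn p : mx_differentiable (fun z => conn A a z p) (phi y).
  by move=> i j; exact: smooth_on_differentiable (conn_smooth A p i j) (phiD Vy).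
have dg : mx_differentiable g y.
  by move=> i j; exact: smooth_on_differentiable (g_smooth i j) Vy.
have dB p : mx_differentiable (fun z => conn A b z p) y.
  by move=> i j; exact: smooth_on_differentiable (conn_smooth A p i j) (VD Vy).
have dAhat p : mx_differentiable (Ahat p) y.
  apply: (@mx_differentiable_sumZ _ _ (fun q => partial p (fun w => phi w 0 q))
    (fun q z => conn A a (phi z) q)) => q.
    exact: smooth_on_differentiable (smooth_on_partial p (phi_smooth q)) Vy.
  exact: (@mx_differentiable_comp _ _ phi (fun z => conn A a z q)).
have pAhat p q : mx_partial p (Ahat q) y =
    \sum_r (partial p (partial q (fun w => phi w 0 r)) y *: conn A a (phi y) r +
      partial q (fun w => phi w 0 r) y *:
        \sum_s partial p (fun w => phi w 0 s) y *:
          mx_partial s (fun z => conn A a z r) (phi y)).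
  rewrite (@mx_partial_sumZ _ _ (fun r => partial q (fun w => phi w 0 r))
    (fun r z => conn A a (phi z) r)) => [|r|r]; last 2 first.
  - exact: smooth_on_differentiable (smooth_on_partial q (phi_smooth r)) Vy.
  - exact: (@mx_differentiable_comp _ _ phi (fun z => conn A a z r)).
  by apply: eq_bigr => r _; rewrite (@mx_partial_comp _ _ phi (fun z => conn A a z r)).
have mxE_partial p i j : (fun z => mx_partial p g z i j) = partial p (fun z => g z i j).
  by apply/funext => z; rewrite mxE.
have dpg p : mx_differentiable (mx_partial p g) y.
  move=> i j; rewrite mxE_partial.
  exact: smooth_on_differentiable (smooth_on_partial p (g_smooth i j)) Vy.
have step p q : mx_partial p g y *m conn A b y q +
      g y *m mx_partial p (fun z => conn A b z q) y =
    mx_partial p (Ahat q) y *m g y + Ahat q y *m mx_partial p g y +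
      mx_partial p (mx_partial q g) y.
  rewrite -mx_partialM// -mx_partialM// -mx_partialD//; last exact: mx_differentiableM.
  by apply: mx_partial_near; apply: filterS nV => z Vz; rewrite g_conn.
(* The common second derivative [H] required by [gauge_curvature]. *)
have gC : mx_partial k (mx_partial l g) y = mx_partial l (mx_partial k g) y.
  apply/matrixP => i j.
  transitivity (partial k (partial l (fun z => g z i j)) y).
    by rewrite -mxE_partial /mx_partial [LHS]mxE.
  rewrite (partialC k l oV (g_smooth i j) Vy).
  by rewrite -mxE_partial /mx_partial [RHS]mxE.
have Ekl := step k l; have Elk := step l k; rewrite gC in Ekl.
have := gauge_curvature (g_conn k Vy) (g_conn l Vy) Ekl Elk.
set FB := (X in g y *m X); set FA := (X in _ = X *m _) => EF.
have -> : curvature A b y k l = FB by [].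
rewrite -mulmxA (_ : (\sum_p _) = FA).
  by rewrite -EF mulmxA (mulmx1C (gg Vy)) mul1mx.
rewrite /FA !pAhat.
have phiC r : partial k (partial l (fun w => phi w 0 r)) y =
    partial l (partial k (fun w => phi w 0 r)) y.
  exact: (partialC k l oV (phi_smooth r) Vy).
under [X in _ = X - _ + _]eq_bigr do rewrite phiC.
exact: sum_scale_curvature.
Qed.
End Change.
End Covariance.

(** * The pointwise inequality *)

Section Pointwise.
Context {R : realType} {X : compact_manifold4 R} {E : so3_bundle X}.
Variable A : metric_connection E.
Implicit Types (a b : triv_idx E) (y : 'rV[R]_4).

Definition vee_form a y (i : 'I_3) : 'I_4 -> 'I_4 -> R :=
  fun k l => vee (curvature A a y k l) 0 i.

Definition gram a y : 'M[R]_3 := \matrix_(i, j) wedge (vee_form a y i) (vee_form a y j).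

Definition perfect_at a y := forall i j,
  wedge (F_ A a y i) (F_ A a y j) = (i == j)%:R * mu A a y.

Lemma vee_form_anti a y i k l : vee_form a y i k l = - vee_form a y i l k.
Proof. by rewrite /vee_form curvature_anti /vee !mxE. Qed.

Lemma wedge_F a y i j : coord_dom a y ->
  wedge (F_ A a y i) (F_ A a y j) = 2 * gram a y i j.
Proof.
move=> Dy; have FE h : F_ A a y h = fun k l => Num.sqrt 2 * vee_form a y h k l.
  apply/funext => k; apply/funext => l.
  by rewrite /F_ so_inner_frame//; exact: curvature_skew.
by rewrite !FE wedgeZ -expr2 sqr_sqrtr// mxE.
Qed.

Lemma muE a y : coord_dom a y -> mu A a y = 2 / 3 * \tr (gram a y).
Proof.
move=> Dy; rewrite /mu; under eq_bigr do rewrite wedge_F//.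
by rewrite -mulr_sumr /mxtrace mulrA (mulrC 2).
Qed.

(** Both sides equal twice the trace of the Gram matrix: the left by [trace_wedge], the right by
    [muE]. *)
Lemma p1_formE a y : coord_dom a y -> 8 * pi ^+ 2 * p1_form A a y = 3 * mu A a y.
Proof.
move=> Dy; rewrite /p1_form trace_wedge; last by move=> k l; exact: curvature_skew.
rewrite muE// /mxtrace; under [in RHS]eq_bigr do rewrite mxE.
have p0 : pi != 0 :> R by rewrite gt_eqF// pi_gt0.
by rewrite /vee_form; move: (\sum_i _) (pi : R) p0 => s p p0; field.
Qed.

(** Since [vee] is injective on skew matrices, definiteness of the connection makes the triple of
    forms [vee_form] definite, and [trace_wedge_neq0] applies. *)
Lemma mu_neq0 a y : definite A -> coord_dom a y -> mu A a y != 0.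
Proof.
move=> dA Dy; rewrite muE// mulf_neq0// /mxtrace; under eq_bigr do rewrite mxE.
apply: trace_wedge_neq0; first exact: vee_form_anti.
move=> u v uv; have := dA a y Dy u v uv.
set M := curvature_at _ _ _ _ _ => M0.
have sM : M^T = - M.
  rewrite /M /curvature_at -sumrN linear_sum; apply: eq_bigr => k _.
  rewrite -sumrN linear_sum; apply: eq_bigr => l _ /=.
  by rewrite linearZ /= curvature_skew// scalerN.
have : vee M != 0.
  apply: contra M0 => /eqP M0; rewrite -(hat_vee sM) M0; apply/eqP/matrixP.
  by apply: ord3P; apply: ord3P; rewrite hatE !mxE ?oppr0.
move=> /rV0Pn[i]; rewrite /M => Mi; exists i; move: Mi; congr (_ != 0).
rewrite mxE summxE; apply: eq_bigr => k _; rewrite summxE; apply: eq_bigr => l _.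
by rewrite mxE; congr (_ * _); rewrite [RHS]mxE.
Qed.

Lemma QE a y i j : Q A a y i j = wedge (F_ A a y i) (F_ A a y j) / mu A a y.
Proof. by rewrite mxE. Qed.

(** The factor 1/3 in [mu] gives [Q] trace 3, as [trace_norm_ge] requires. *)
Lemma normQ2_sub3 a y : coord_dom a y -> mu A a y != 0 ->
  normQ2 A a y - 3 = \sum_i \sum_j (Q A a y i j - (i == j)%:R) ^+ 2.
Proof.
move=> Dy m0; apply: trace_norm_ge; first by apply/matrixP => i j; rewrite mxE !QE wedgeC.
rewrite /mxtrace; under eq_bigr do rewrite mxE.
rewrite -mulr_suml (_ : \sum_i _ = 3 * mu A a y) ?mulfK// /mu mulrA mulfV ?mul1r//.
Qed.

Lemma normQ2_ge3 a y : coord_dom a y -> mu A a y != 0 -> 3 <= normQ2 A a y.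
Proof.
move=> Dy m0; rewrite -subr_ge0 normQ2_sub3//.
by do 2 (apply: sumr_ge0 => ? _); exact: sqr_ge0.
Qed.

Lemma normQ2_eq3 a y : coord_dom a y -> mu A a y != 0 ->
  normQ2 A a y = 3 <-> perfect_at a y.
Proof.
move=> Dy m0; split=> [/eqP|p].
  rewrite -subr_eq0 normQ2_sub3// => /eqP s0 i j.
  have s1 : \sum_j (Q A a y i j - (i == j)%:R) ^+ 2 = 0.
    by apply: (psumr_eq0P _ s0) => // h _; apply: sumr_ge0 => ? _; exact: sqr_ge0.
  have /eqP : (Q A a y i j - (i == j)%:R) ^+ 2 = 0.
    by apply: (psumr_eq0P _ s1) => // h _; exact: sqr_ge0.
  by rewrite sqrf_eq0 subr_eq0 mxE => /eqP <-; rewrite divfK.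
apply/eqP; rewrite -subr_eq0 normQ2_sub3//; apply/eqP.
do 2 (apply: big1 => ? _); rewrite mxE p mulfK// subrr expr0n//.
Qed.

(** The trace determines the scalar: mu = 2 c. *)
Lemma perfect_at_gram a y c : coord_dom a y -> gram a y = c%:M -> perfect_at a y.
Proof.
move=> Dy gc i j; rewrite wedge_F// muE// gc mxtrace_scalar mxE.
case: (i == j); rewrite ?mulr1n ?mulr0n ?mul1r ?mul0r ?mulr0//.
by field.
Qed.

(** The Gram matrix at [b] is d P^T G P, with G the one at [a], [P] orthogonal and [d] the Jacobian
    factor. If it is scalar, then so is d G, and [d] is nonzero because [mu] is nonzero in the frame
    [b]. *)
Lemma perfect_at_transfer a b (x : X) : definite A -> triv_dom a x -> triv_dom b x ->
  perfect_at b (coord b x) -> perfect_at a (coord a x).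
Proof.
move=> dA xa xb pb; set y := coord b x.
have Vy : (coord b @` (triv_dom a `&` triv_dom b)) y by exists x.
have Dy : coord_dom b y by exists x.
have Dx : coord_dom a (coord a x) by exists x.
have phiy : coord_change a b y = coord a x by rewrite /coord_change icoordK.
pose J : 'M[R]_4 := \matrix_(p, k) partial k (fun z => coord_change a b z 0 p) y.
have [P PP veeP] := vee_conj (transition_orthogonal Vy).
have vb i : vee_form b y i =
    fun k l => \sum_m P m i * pullback J (vee_form a (coord a x) m) k l.
  apply/funext => k; apply/funext => l.
  rewrite /vee_form (curvature_transition A k l Vy) phiy veeP.
    rewrite mxE; apply: eq_bigr => m _; rewrite mulrC; congr (_ * _).
    rewrite /pullback mxE summxE; apply: eq_bigr => p _.
    by rewrite summxE; apply: eq_bigr => q _; rewrite !mxE.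
  rewrite -sumrN linear_sum; apply: eq_bigr => p _.
  rewrite -sumrN linear_sum; apply: eq_bigr => q _ /=.
  by rewrite linearZ /= curvature_skew// scalerN.
have [d dP] := wedge_pullback J.
have gE : gram b y = d *: (P^T *m gram a (coord a x) *m P).
  apply/matrixP => i j; rewrite mxE !vb wedge_sum !mxE mulr_sumr.
  rewrite exchange_big; apply: eq_bigr => n _ /=; rewrite mxE mulr_suml mulr_sumr.
  apply: eq_bigr => m _; rewrite !mxE dP; first by ring.
    exact: vee_form_anti.
  exact: vee_form_anti.
have m0 := mu_neq0 dA Dy.
have gb : gram b y = (mu A b y / 2)%:M.
  apply/matrixP => i j; have := pb i j; rewrite wedge_F// => h.
  apply: (@mulfI _ 2) => //; rewrite h [in RHS]mxE; case: (i == j);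
    rewrite ?mulr1n ?mulr0n ?mulr0 ?mul0r//.
  by rewrite mul1r; field.
have PPt : P *m P^T = 1%:M by exact: mulmx1C.
have : d *: gram a (coord a x) = (mu A b y / 2)%:M.
  have PgP : P *m (P^T *m gram a (coord a x) *m P) *m P^T = gram a (coord a x).
    by rewrite !mulmxA PPt mul1mx -mulmxA PPt mulmx1.
  rewrite -PgP scalemxAl scalemxAr -gE gb.
  by rewrite mul_mx_scalar -scalemxAl PPt scalemx1.
move=> dg; have d0 : d != 0.
  apply: contra_neq m0 => d0; have := congr1 (fun M : 'M[R]_3 => M 0 0) dg.
  by rewrite d0 scale0r !mxE eqxx mulr1n; lra.
apply: (@perfect_at_gram _ _ (d^-1 * (mu A b y / 2))) => //.
by rewrite -scale_scalar_mx -dg scalerA mulVf// scale1r.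
Qed.

End Pointwise.

(** * Integration over X *)

Section ContinuousAt.
Context {R : realType} {T : topologicalType} (y : T).
Implicit Types f g : T -> R.

Lemma continuous_at_add f g : {for y, continuous f} -> {for y, continuous g} ->
  {for y, continuous (fun z => f z + g z)}.
Proof. exact: continuousD. Qed.

Lemma continuous_at_sub f g : {for y, continuous f} -> {for y, continuous g} ->
  {for y, continuous (fun z => f z - g z)}.
Proof. exact: continuousB. Qed.

Lemma continuous_at_mul f g : {for y, continuous f} -> {for y, continuous g} ->
  {for y, continuous (fun z => f z * g z)}.
Proof. exact: continuousM. Qed.

Lemma continuous_at_cst (c : R) : {for y, continuous (fun _ : T => c)}.
Proof. exact: cvg_cst. Qed.

Lemma continuous_at_sum n (f : 'I_n -> T -> R) : (forall i, {for y, continuous (f i)}) ->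
  {for y, continuous (fun z => \sum_i f i z)}.
Proof.
by move=> cf; apply: cvg_big => [|i _]; [exact: add_continuous|exact: cf].
Qed.

Lemma continuous_at_inv f : f y != 0 -> {for y, continuous f} ->
  {for y, continuous (fun z => (f z)^-1)}.
Proof. exact: continuousV. Qed.

Lemma continuous_at_norm f : {for y, continuous f} -> {for y, continuous (fun z => `|f z|)}.
Proof. exact: cvg_norm. Qed.

End ContinuousAt.

(** * The difference of the two integrands in a chart *)

Section Gap.
Context {R : realType} {X : compact_manifold4 R} {E : so3_bundle X}.
Variable A : metric_connection E.
Hypothesis dA : definite A.
Implicit Types (a : triv_idx E) (y : 'rV[R]_4).

Lemma curvature_continuous a y k l i j : coord_dom a y ->
  {for y, continuous (fun z => curvature A a z k l i j)}.
Proof.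
move=> Dy.
have c0 p i' j' : {for y, continuous (fun z => conn A a z p i' j')}.
  exact/differentiable_continuous/(smooth_on_differentiable (conn_smooth A p i' j') Dy).
have c1 q p i' j' : {for y, continuous (partial q (fun z => conn A a z p i' j'))}.
  apply: differentiable_continuous.
  exact: (smooth_on_differentiable (smooth_on_partial q (conn_smooth A p i' j')) Dy).
have -> : (fun z => curvature A a z k l i j) = (fun z =>
    partial k (fun w => conn A a w l i j) z - partial l (fun w => conn A a w k i j) z
    + lie_bracket (conn A a z k) (conn A a z l) i j).
  by apply/funext => z; rewrite curvatureE.
apply: continuous_at_add; first by apply: continuous_at_sub; exact: c1.
rewrite (_ : (fun z => _) = fun z =>
  conn A a z k i 0 * conn A a z l 0 j + conn A a z k i 1 * conn A a z l 1 j
  + conn A a z k i 2 * conn A a z l 2 j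
  - (conn A a z l i 0 * conn A a z k 0 j + conn A a z l i 1 * conn A a z k 1 j
  + conn A a z l i 2 * conn A a z k 2 j)); last by apply/funext => z; rewrite lie_bracketE.
by apply: continuous_at_sub; do 2 (try apply: continuous_at_add);
  apply: continuous_at_mul; exact: c0.
Qed.

Lemma gram_continuous a y i j : coord_dom a y -> {for y, continuous (fun z => gram A a z i j)}.
Proof.
move=> Dy.
have c k l h : {for y, continuous (fun z => vee_form A a z h k l)}.
  rewrite (_ : (fun z => _) = fun z => curvature A a z k l (h + 2) (h + 1)).
    exact: curvature_continuous.
  by apply/funext => z; rewrite /vee_form /vee mxE.
rewrite (_ : (fun z => _) = fun z => wedge (vee_form A a z i) (vee_form A a z j)); last first.
  by apply/funext => z; rewrite mxE.
rewrite /wedge.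
by do 5 (try (apply: continuous_at_sub || apply: continuous_at_add));
  apply: continuous_at_mul; exact: c.
Qed.

(* |mu| and |Q|^2, through the entries of the curvature, whose continuity is known;
   the agreement holds on coord_dom a only. *)
Definition gram_vol a y : R := `|2 / 3 * \tr (gram A a y)|.

Definition gram_norm a y : R := \sum_i \sum_j
  (2 * gram A a y i j / (2 / 3 * \tr (gram A a y))) *
  (2 * gram A a y j i / (2 / 3 * \tr (gram A a y))).

Lemma gram_volE a y : coord_dom a y -> gram_vol a y = `|mu A a y|.
Proof. by move=> Dy; rewrite muE. Qed.

Lemma gram_normE a y : coord_dom a y -> gram_norm a y = normQ2 A a y.
Proof.
move=> Dy; rewrite /normQ2; do 2 (apply: eq_bigr => ? _).
by rewrite !QE !wedge_F// muE.
Qed.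

Let trace_continuous a y : coord_dom a y ->
  {for y, continuous (fun z => 2 / 3 * \tr (gram A a z))}.
Proof.
move=> Dy; apply: continuous_at_mul; first exact: continuous_at_cst.
by apply: continuous_at_sum => i; exact: gram_continuous.
Qed.

Lemma gram_vol_continuous a y : coord_dom a y -> {for y, continuous (gram_vol a)}.
Proof. by move=> Dy; apply: continuous_at_norm; exact: trace_continuous. Qed.

Lemma gram_norm_continuous a y : coord_dom a y -> {for y, continuous (gram_norm a)}.
Proof.
move=> Dy; apply: continuous_at_sum => i; apply: continuous_at_sum => j.
(* Definiteness makes the denominator nonzero. *)
have nz : 2 / 3 * \tr (gram A a y) != 0 by rewrite -muE//; exact: mu_neq0.
have c p q : {for y, continuous (fun z =>
    2 * gram A a z p q / (2 / 3 * \tr (gram A a z)))}.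
  apply: continuous_at_mul.
    by apply: continuous_at_mul; [exact: continuous_at_cst|exact: gram_continuous].
  by apply: continuous_at_inv => //; exact: trace_continuous.
by apply: continuous_at_mul; exact: c.
Qed.

Variable P : partition_of_unity E.

(** The support in coordinates: a compact subset of the chart image, in the role of [K] in the
    lemmas on integrals over R^4. *)
Definition pou_support (k : 'I_(pou_size P)) : set 'rV[R]_4 :=
  coord (pou_idx k) @` closure [set x | pou_fun k x != 0].

Lemma pou_support_compact k : compact (pou_support k).
Proof.
apply: continuous_compact.
  apply: continuous_in_subspaceT => x; rewrite inE => /pou_supp/triv_dom_chart.
  exact: chart_continuous.
apply: (subclosed_compact _ (points_compact (c := X))) => //.
exact: closed_closure.
Qed.

Lemma pou_support_sub k : pou_support k `<=` coord_dom (pou_idx k).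
Proof. by move=> _ [x /pou_supp xa <-]; exists x. Qed.

Definition chi (k : 'I_(pou_size P)) y : R := pou_fun k (icoord (pou_idx k) y).

Lemma chi_continuous k y : coord_dom (pou_idx k) y -> {for y, continuous (chi k)}.
Proof.
move=> Dy; apply: continuous_comp; last exact: pou_continuous.
apply: ichart_continuous; case: Dy => x /triv_dom_chart cx <-; by exists x.
Qed.

Lemma chi_support k y : coord_dom (pou_idx k) y -> ~ pou_support k y -> chi k y = 0.
Proof.
move=> [x xa <-] nK; apply: contrapT => /eqP; rewrite /chi icoordK// => chi0.
by apply: nK; exists x => //; exact: subset_closure.
Qed.

Lemma chi_ge0 k y : 0 <= chi k y. Proof. exact: pou_ge0. Qed.

(** The contribution of one chart to the integrand of E(A) - 8 pi^2 p_1(E). The orientation sign has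
    turned [mu] into its absolute value. *)
Definition gap (k : 'I_(pou_size P)) y : R :=
  chi k y * (gram_vol (pou_idx k) y * (gram_norm (pou_idx k) y - 3)).

Section Integrands.
Variable k : 'I_(pou_size P).
Let a := pou_idx k.
Let D := of_coords @^-1` coord_dom a : set (R * R * R * R).

Let integrable_chi f : (forall y, coord_dom a y -> {for y, continuous f}) ->
  leb4.-integrable D (EFin \o ((fun y => chi k y * f y) \o of_coords)).
Proof.
move=> cf; apply: (@integrable_continuous _ _ (pou_support k)).
- exact: coord_dom_open.
- exact: pou_support_compact.
- exact: pou_support_sub.
- by move=> y Dy; apply: continuous_at_mul; [exact: chi_continuous|exact: cf].
- by move=> y Dy nK; rewrite chi_support// mul0r.
Qed.

Lemma gap_continuous y : coord_dom a y -> {for y, continuous (gap k)}.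
Proof.
move=> Dy; apply: continuous_at_mul; first exact: chi_continuous.
apply: continuous_at_mul; first exact: gram_vol_continuous.
by apply: continuous_at_sub; [exact: gram_norm_continuous|exact: continuous_at_cst].
Qed.

Lemma gap_ge0 y : coord_dom a y -> 0 <= gap k y.
Proof.
move=> Dy; rewrite /gap mulr_ge0 ?chi_ge0// mulr_ge0 ?normr_ge0//.
by rewrite gram_normE// subr_ge0 normQ2_ge3//; exact: mu_neq0.
Qed.

Lemma gap_eq0 y : coord_dom a y -> chi k y != 0 -> gap k y = 0 <-> perfect_at A a y.
Proof.
move=> Dy c0; have m0 := mu_neq0 dA Dy.
rewrite -normQ2_eq3// /gap gram_volE// gram_normE//; split=> [/eqP|->].
  by rewrite !mulf_eq0 (negPf c0) normr_eq0 (negPf m0) subr_eq0 => /eqP.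
by rewrite subrr !mulr0.
Qed.

(** The identities o mu = |mu| and 8 pi^2 p_1(A) = 3 mu make both integrands products of [chi k]
    with functions continuous on the chart image. These are integrable, so the integrals may be
    combined. *)
Lemma integral_gap :
  \int[leb4]_(p in D) (chi k (of_coords p) * orientation A a (of_coords p)
     * (normQ2 A a (of_coords p) * mu A a (of_coords p)))
  - 8 * pi ^+ 2 * \int[leb4]_(p in D) (chi k (of_coords p)
     * orientation A a (of_coords p) * p1_form A a (of_coords p))
  = \int[leb4]_(p in D) gap k (of_coords p).
Proof.
have mD := measurable_preimage_open (@coord_dom_open _ _ _ a).
have pi1 : pi != 0 :> R by rewrite gt_eqF// pi_gt0.
have pi0 : 8 * pi ^+ 2 != 0 :> R by rewrite mulf_eq0 expf_eq0 (negPf pi1) pnatr_eq0.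
have sgmu y : orientation A a y * mu A a y = `|mu A a y| by rewrite normrEsg.
have -> : \int[leb4]_(p in D) (chi k (of_coords p) * orientation A a (of_coords p)
     * (normQ2 A a (of_coords p) * mu A a (of_coords p))) =
  \int[leb4]_(p in D) (chi k (of_coords p) *
     (gram_norm a (of_coords p) * gram_vol a (of_coords p))).
  apply: eq_Rintegral => p; rewrite inE => Dp.
  by rewrite gram_normE// gram_volE// -sgmu; ring.
have -> : \int[leb4]_(p in D) (chi k (of_coords p)
     * orientation A a (of_coords p) * p1_form A a (of_coords p)) =
  \int[leb4]_(p in D) (chi k (of_coords p) *
     (3 / (8 * pi ^+ 2) * gram_vol a (of_coords p))).
  apply: eq_Rintegral => p; rewrite inE => Dp.
  rewrite gram_volE// -sgmu; apply: (mulfI pi0).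
  rewrite mulrCA p1_formE//.
  by move: (chi _ _) (orientation _ _ _) (mu _ _ _) (pi : R) pi1 => c o m p' p0; field.
have c1 y : coord_dom a y -> {for y, continuous (fun y => gram_norm a y * gram_vol a y)}.
  move=> Dy; apply: continuous_at_mul; first exact: gram_norm_continuous.
  exact: gram_vol_continuous.
have c2 y : coord_dom a y -> {for y, continuous (fun y => 3 / (8 * pi ^+ 2) * gram_vol a y)}.
  move=> Dy; apply: continuous_at_mul; first exact: continuous_at_cst.
  exact: gram_vol_continuous.
have c3 y : coord_dom a y ->
    {for y, continuous (fun y => 8 * pi ^+ 2 * (3 / (8 * pi ^+ 2) * gram_vol a y))}.
  by move=> Dy; apply: continuous_at_mul; [exact: continuous_at_cst|exact: c2].
rewrite -RintegralZl//; last exact: integrable_chi c2.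
have -> : \int[leb4]_(p in D) (8 * pi ^+ 2 * (chi k (of_coords p) *
     (3 / (8 * pi ^+ 2) * gram_vol a (of_coords p)))) =
  \int[leb4]_(p in D) (chi k (of_coords p) *
     (8 * pi ^+ 2 * (3 / (8 * pi ^+ 2) * gram_vol a (of_coords p)))).
  by apply: eq_Rintegral => p _; rewrite mulrCA.
rewrite -RintegralB//; [|exact: integrable_chi c1|exact: integrable_chi c3].
apply: eq_Rintegral => p _; rewrite /gap -/a.
rewrite (mulrA (8 * pi ^+ 2)) (mulrCA (8 * pi ^+ 2) 3) mulfV//.
by rewrite mulr1; ring.
Qed.

End Integrands.

Lemma integral_gap_ge0 k :
  0 <= \int[leb4]_(p in of_coords @^-1` coord_dom (pou_idx k)) gap k (of_coords p).
Proof. by apply: Rintegral_ge0 => p Dp; exact: gap_ge0. Qed.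

Lemma integral_gap_eq0 k :
  \int[leb4]_(p in of_coords @^-1` coord_dom (pou_idx k)) gap k (of_coords p) = 0 ->
  forall y, coord_dom (pou_idx k) y -> gap k y = 0.
Proof.
apply: (@integral_continuous_eq0 _ _ (pou_support k)).
- exact: coord_dom_open.
- exact: pou_support_compact.
- exact: pou_support_sub.
- exact: gap_continuous.
- by move=> y Dy nK; rewrite /gap chi_support// mul0r.
- exact: gap_ge0.
Qed.

End Gap.

Local Close Scope classical_set_scope.

Theorem proposition1p12 (R : realType) (X : compact_manifold4 R)
    (E : so3_bundle X) (A : metric_connection E) (hA : definite A) :
  8 * pi ^+ 2 * p1_number A <= energy A /\
  (energy A = 8 * pi ^+ 2 * p1_number A <-> perfect A).
Proof.
rewrite /energy /p1_number /form_integral /=.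
set P := inhabited_witness _.
set p1 := \sum_(k < _) _; set en := \sum_(k < _) _.
(* Both numbers are computed with the same partition of unity [P], so they are compared chart by
   chart. *)
have gapE : en - 8 * pi ^+ 2 * p1 = \sum_(k < pou_size P)
    \int[leb4]_(p in (of_coords @^-1` coord_dom (pou_idx k))%classic) gap A k (of_coords p).
  rewrite /en /p1 mulr_sumr -sumrB; apply: eq_bigr => k _.
  exact: (integral_gap hA k).
have gap0 : 0 <= en - 8 * pi ^+ 2 * p1.
  by rewrite gapE; apply: sumr_ge0 => k _; exact: integral_gap_ge0.
split; first by rewrite -subr_ge0.
split=> [eq|pA].
- have s0 : \sum_(k < pou_size P)
      \int[leb4]_(p in (of_coords @^-1` coord_dom (pou_idx k))%classic)
         gap A k (of_coords p) = 0.
    by rewrite -gapE eq subrr.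
  have I0 k := psumr_eq0P (fun i _ => integral_gap_ge0 hA i) s0 (i := k) isT.
  move=> a _ [x xa <-].
  (* The functions of the partition sum to 1, so one of them is nonzero at [x]. In its frame the
     vanishing gap gives perfection, which is then carried to the frame [a]. *)
  have [k ck] : exists k : 'I_(pou_size P), pou_fun k x != 0.
    apply: contrapT => /forallNP n; have := pou_sum1 P x.
    rewrite big1 => [/esym/eqP|k _]; first by rewrite oner_eq0.
    by apply/eqP/negPn/negP; exact: n.
  have xk : triv_dom (pou_idx k) x by apply: pou_supp; exact: subset_closure.
  have Dk : coord_dom (pou_idx k) (coord (pou_idx k) x) by exists x.
  apply: (perfect_at_transfer hA xa xk).
  apply/(gap_eq0 hA Dk); first by rewrite /chi icoordK.
  exact: (integral_gap_eq0 hA (I0 k)).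
(* Conversely, perfection gives |Q|^2 = 3 everywhere, and every gap vanishes pointwise. *)
- apply/eqP; rewrite -subr_eq0 gapE; apply/eqP/big1 => k _.
  rewrite /Rintegral integral0_eq// => p Dp; congr (_%:E).
  have m0 := mu_neq0 hA Dp; have /(normQ2_eq3 Dp m0) n3 := pA _ _ Dp.
  by rewrite /gap gram_normE// n3 subrr !mulr0.
Qed.
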